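(* Let $Z$ be a striped surface with a fixed striped atlas $q: Z_0=\bigsqcup_{\alpha\in A} S_\alpha \to Z$, let $G$ be the graph of the striped atlas $q$, and let $\varphi: G\to Z$ be the canonical continuous injection (constructed for any choice of points $z_\beta$ in the seams $\omega_\beta$, $\beta\in B$). Then there exists a subset $Z'\subset Z$ such that the map $\varphi$ induces an isomorphism of the corresponding fundamental groupoids $$\varphi^*:\Pi_1\bigl(G,\varphi^{-1}(Z')\bigr)\to\Pi_1(Z,Z').$$
   Context: **Model strips.** A subset $S\subset\mathbb{R}\times[-1,1]$ is a *model strip* if (1) $\mathbb{R}\times(-1,1)\subset S$, and (2) $S\cap(\mathbb{R}\times\{\pm1\})$ is a union of at most countably many mutually disjoint open intervals (equivalently, $S$ is open in $\mathbb{R}\times[-1,1]$). Put $\partial_-S=S\cap(\mathbb{R}\times\{-1\})$, $\partial_+S=S\cap(\mathbb{R}\times\{1\})$, $\partial S=\partial_-S\cup\partial_+S$. The boundary intervals of $S$ are the connected components of $\partial S$. **Striped atlas.** Let $Z$ be a two-dimensional manifold (possibly non-orientable, disconnected, with boundary). A *striped atlas* on $Z$ is a map $q: Z_0\to Z$ such that: 1. $Z_0=\bigsqcup_{\alpha\in A}S_\alpha$ is an at most countable disjoint union of model strips; 2. $q$ is a quotient map; 3. there are two disjoint families $X=\{X_\beta\}_{\beta\in B}$ and $Y=\{Y_\beta\}_{\beta\in B}$ of boundary intervals in $\bigcup_{\alpha\in A}\partial S_\alpha$ such that (writing $X\cup Y$ also for the union of all intervals of the two families): (a) $q$ is injective on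 $Z_0\setminus(X\cup Y)$; (b) $q(X_\beta)=q(Y_\beta)$ for each $\beta\in B$, and the restrictions $q|_{X_\beta}:X_\beta\to q(X_\beta)$ and $q|_{Y_\beta}:Y_\beta\to q(Y_\beta)$ are embeddings; (c) $q(X_\beta)\cap q(X_{\beta'})=\varnothing$ for $\beta\neq\beta'\in B$; (d) $q(X_\beta)\cap q(Z_0\setminus(X\cup Y))=\varnothing$ for each $\beta\in B$. A *striped surface* is a surface admitting a striped atlas; one such atlas is fixed. The set $\omega_\beta=q(X_\beta)=q(Y_\beta)$ is called a *seam*. **Graph of the atlas.** $G$ is the one-dimensional CW-complex with $0$-skeleton $G^{(0)}=A$ and, for each $\beta\in B$, one $1$-cell $I_\beta=[-1,1]$ attached via $\chi_\beta:\{\pm1\}\to A$, $\chi_\beta(-1)=\alpha$, $\chi_\beta(1)=\alpha'$, where $X_\beta\subset\partial S_\alpha$ and $Y_\beta\subset\partial S_{\alpha'}$ (possibly $\alpha=\alpha'$). $G$ carries the CW (weak) topology. The characteristic map is also denoted $\chi_\beta: I_\beta\to G$. **Canonical injection $\varphi:G\to Z$.** For $\alpha\in A$ let $s_\alpha=(0,0)\in\mathbb{R}\times(-1,1)\subset S_\alpha$ and put $\varphi(\alpha)=q(s_\alpha)$. For each $\beta\in B$ fix a point $z_\beta\in\omega_\beta$; let $(x_\beta,\varepsilon)$ be the unique point of $q^{-1}(z_\beta)\cap X_\beta$ and $(y_\beta,\varepsilon')$ the unique point of $q^{-1}(z_\beta)\cap Y_\beta$, where $\varepsilon,\varepsilon'\in\{\pm1\}$.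 With $X_\beta\subset S_\alpha$ and $Y_\beta\subset S_{\alpha'}$, define $\varphi_\beta:I_\beta=[-1,1]\to Z$ by $$\varphi_\beta(t)=\begin{cases} q\bigl(2(1+t)x_\beta,(1+t)\varepsilon\bigr), & t\in[-1,-\tfrac12],\\ q\bigl(x_\beta,(1+t)\varepsilon\bigr), & t\in[-\tfrac12,0],\\ q\bigl(y_\beta,(1-t)\varepsilon'\bigr), & t\in[0,\tfrac12],\\ q\bigl(2(1-t)y_\beta,(1-t)\varepsilon'\bigr), & t\in[\tfrac12,1],\end{cases}$$ where the arguments of $q$ are points of $S_\alpha$ in the first two lines and of $S_{\alpha'}$ in the last two. The paths $\varphi_\beta$ agree with $\varphi$ on $G^{(0)}$ at their endpoints, and $\varphi:G\to Z$ is the resulting continuous injective map, with $\varphi\circ\chi_\beta=\varphi_\beta$. **Fundamental groupoid.** For a topological space $W$ and a subset $W'\subset W$, $\Pi_1(W,W')$ is the groupoid whose set of objects (base points) is $W'$ and whose morphisms are the homotopy classes relative to $\{0,1\}$ of continuous paths $[0,1]\to W$ with both endpoints in $W'$, with composition given by concatenation of paths. A continuous map of pairs $f:(W,W')\to(V,V')$ induces a morphism of groupoids (functor) $f^*:\Pi_1(W,W')\to\Pi_1(V,V')$. *)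

(* Defs.v *)
From HB Require Import structures.
From mathcomp Require Import all_boot all_order all_algebra.
From mathcomp Require Import all_classical all_reals all_analysis.
From mathcomp Require Import ring lra.
Import Order.TTheory GRing.Theory Num.Theory.
Import numFieldNormedType.Exports.

Set Implicit Arguments.
Unset Strict Implicit.
Unset Printing Implicit Defensive.

Local Open Scope classical_set_scope.
Local Open Scope ring_scope.
Local Open Scope quotient_scope.

Lemma within_eq (T U : topologicalType) (A : set T) (f g : T -> U) :
  (forall x, A x -> f x = g x) ->
  {within A, continuous f} -> {within A, continuous g}.
Proof.
move=> fg cf; apply: (@subspace_eq_continuous _ A _ f g) => //.
by move=> x /set_mem; exact: fg.
Qed.

Lemma within_comp (T U V : topologicalType) (A : set T) (B : set U)
    (f : T -> U) (g : U -> V) :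
  (forall x, A x -> B (f x)) -> {within A, continuous f} ->
  {within B, continuous g} -> {within A, continuous (fun x => g (f x))}.
Proof.
move=> fAB /subspace_continuousP cf /subspace_continuousP cg.
apply/subspace_continuousP => x Ax.
have cgx := cg _ (fAB _ Ax).
move=> O /cgx nB.
have nA : nbhs x [set y | A y -> B (f y) -> O (g (f y))] by exact: cf _ Ax _ nB.
suff : nbhs x [set y | A y -> O (g (f y))] by [].
by apply: filterS nA => y H Ay; apply: H => //; exact: fAB.
Qed.

Lemma within_paste (T U : topologicalType) (A B D : set T) (f g h : T -> U) :
  closed A -> closed B -> D `<=` A `|` B ->
  (forall x, A x -> h x = f x) -> (forall x, B x -> h x = g x) ->
  {within A, continuous f} -> {within B, continuous g} ->
  {within D, continuous h}.
Proof.
move=> cA cB DAB hf hg cf cg; apply: (continuous_subspaceW DAB).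
apply: withinU_continuous => //.
- by apply: within_eq cf => x /hf.
- by apply: within_eq cg => x /hg.
Qed.

Section Surfaces.
Variable R : realType.

Definition embedding_on (T U : topologicalType) (D : set T) (f : T -> U) :=
  {within D, continuous f} /\
  exists2 g : U -> T, {within f @` D, continuous g} &
                      (forall x, D x -> g (f x) = x).

(* Models both the interior and the boundary charts. *)
Definition half_plane : set (R * R) := [set p | 0 <= p.2].

Definition surface (Z : topologicalType) :=
  [/\ hausdorff_space Z, @second_countable Z &
      forall z : Z, exists (U : set Z) (f : Z -> R * R),
        [/\ open U, U z, embedding_on U f &
            exists2 O : set (R * R), open O & f @` U = O `&` half_plane]].

Definition strip_boundary (S : set (R * R)) : set (R * R) :=
  S `&` [set p | p.2 = -1 \/ p.2 = 1].

Definition open_boundary_interval (J : set (R * R)) :=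
  exists (I : set R) (e : R),
    [/\ is_interval I, open I, e = -1 \/ e = 1 & J = I `*` [set e]].

Record model_strip (S : set (R * R)) : Prop := ModelStrip {
  strip_closed_sub : S `<=` [set p | -1 <= p.2 <= 1];
  strip_open_sub : [set p | -1 < p.2 < 1] `<=` S;
  strip_boundary_intervals : exists F : set (set (R * R)),
    [/\ countable F, F `<=` open_boundary_interval, trivIset F id &
        strip_boundary S = \bigcup_(J in F) J] }.

Definition boundary_interval (S J : set (R * R)) :=
  exists2 p, strip_boundary S p & J = connected_component (strip_boundary S) p.

Definition strip_space (S : set (R * R)) : topologicalType := set_type S.

Definition strip_sum (A : countType) (S : A -> set (R * R)) : topologicalType :=
  {a : A & strip_space (S a)}.

Definition quotient_map (T U : topologicalType) (f : T -> U) :=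
  range f = setT /\ forall O : set U, open O <-> open (f @^-1` O).

(* The copy of [J] lying in the summand of index [a]. *)
Definition in_strip (A : countType) (S : A -> set (R * R)) (a : A)
    (J : set (R * R)) : set (strip_sum S) :=
  [set u | projT1 u = a /\ J (set_val (projT2 u))].

End Surfaces.

Record striped_atlas (R : realType) (Z : topologicalType) := StripedAtlas {
  strip_index : countType;
  seam_index : Type;
  strip : strip_index -> set (R * R);
  stripP : forall a, model_strip (strip a);
  glue : strip_sum strip -> Z;
  glue_quotient : quotient_map glue;
  Xstrip : seam_index -> strip_index;
  Ystrip : seam_index -> strip_index;
  Xitv : seam_index -> set (R * R);
  Yitv : seam_index -> set (R * R);
  Xset := fun b => in_strip (S := strip) (Xstrip b) (Xitv b);
  Yset := fun b => in_strip (S := strip) (Ystrip b) (Yitv b);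
  glued := \bigcup_b (Xset b `|` Yset b);
  Xitv_boundary : forall b, boundary_interval (strip (Xstrip b)) (Xitv b);
  Yitv_boundary : forall b, boundary_interval (strip (Ystrip b)) (Yitv b);
  XY_disjoint : forall b b', Xset b `&` Yset b' = set0;
  glue_inj : forall u v, ~ glued u -> ~ glued v -> glue u = glue v -> u = v;
  glue_XY : forall b, glue @` Xset b = glue @` Yset b;
  glue_X_embedding : forall b, embedding_on (Xset b) glue;
  glue_Y_embedding : forall b, embedding_on (Yset b) glue;
  seams_disjoint : forall b b', b <> b' ->
    (glue @` Xset b) `&` (glue @` Xset b') = set0;
  seam_unglued : forall b, (glue @` Xset b) `&` (glue @` ~` glued) = set0 }.

Arguments strip {R Z}.
Arguments stripP {R Z}.
Arguments glue {R Z}.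
Arguments glue_quotient {R Z}.
Arguments Xstrip {R Z}.
Arguments Ystrip {R Z}.
Arguments Xitv {R Z}.
Arguments Yitv {R Z}.
Arguments Xset {R Z}.
Arguments Yset {R Z}.
Arguments glued {R Z}.
Arguments Xitv_boundary {R Z}.
Arguments Yitv_boundary {R Z}.
Arguments XY_disjoint {R Z}.
Arguments glue_XY {R Z}.
Arguments glue_X_embedding {R Z}.
Arguments glue_Y_embedding {R Z}.
Arguments seam_unglued {R Z}.

Definition seam (R : realType) (Z : topologicalType) (q : striped_atlas R Z)
    (b : seam_index q) : set Z := glue q @` Xset q b.

(* The one-dimensional CW-complex with set of vertices [A] and, for every
   [b : B], one 1-cell [-1, 1] attached to [src b] at -1 and [dst b] at 1: its
   points are the vertices and the interior points of the cells. *)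
Inductive graph (R : realType) (A B : Type) (src dst : B -> A) : Type :=
| Vertex of A
| EdgePoint of B & {t : R | -1 < t < 1}.
Arguments Vertex {R A B src dst}.
Arguments EdgePoint {R A B src dst}.

Section Graph.
Variables (R : realType) (A B : Type) (src dst : B -> A).

HB.instance Definition _ := gen_eqMixin (graph R src dst).
HB.instance Definition _ := gen_choiceMixin (graph R src dst).

(* Only the values on [-1, 1] matter. *)
Definition char_map (b : B) (t : R) : graph R src dst :=
  if insub t is Some s then EdgePoint b s
  else Vertex (if t <= 0 then src b else dst b).

(* The weak topology: a set is open iff its preimages under all characteristic
   maps are open in [-1, 1]. *)
Definition graph_open (U : set (graph R src dst)) :=
  forall b, open (char_map b @^-1` U : set (subspace `[(-1 : R), 1])).

Lemma graph_openT : graph_open setT.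
Proof. by move=> b; rewrite preimage_setT; exact: openT. Qed.

Lemma graph_openI : setI_closed graph_open.
Proof.
by move=> U V oU oV b; rewrite preimage_setI; apply: openI; [exact: oU|exact: oV].
Qed.

Lemma graph_open_bigcup (I : Type) (f : I -> set (graph R src dst)) :
  (forall i, graph_open (f i)) -> graph_open (\bigcup_i f i).
Proof.
move=> of_ b; rewrite preimage_bigcup; apply: bigcup_open => i _; exact: of_.
Qed.

HB.instance Definition _ := isOpenTopological.Build (graph R src dst)
  graph_openT graph_openI graph_open_bigcup.

Lemma graph_continuous (T : topologicalType) (f : graph R src dst -> T) :
  (forall b, {within `[(-1 : R), 1], continuous (fun t => f (char_map b t))}) ->
  continuous f.
Proof.
move=> cf; apply/continuousP => U oU.
suff : graph_open (f @^-1` U) by [].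
by move=> b; have /continuousP := cf b; apply.
Qed.

End Graph.

Section CanonicalMap.
Variables (R : realType) (Z : topologicalType) (q : striped_atlas R Z).

Lemma strip_center_subproof (a : strip_index q) : (0, 0) \in strip q a.
Proof.
apply/mem_set; apply: (strip_open_sub (stripP q a)); rewrite /=; lra.
Qed.

Definition strip_center (a : strip_index q) : strip_sum (strip q) :=
  existT (fun a => strip_space (strip q a)) a (SigSub (strip_center_subproof a)).

(* The point [p] of the strip q of index [a]; meaningful for [p] in that strip. *)
Definition strip_point (a : strip_index q) (p : R * R) :
    strip_sum (strip q) :=
  existT (fun a => strip_space (strip q a)) a
    (insubd (SigSub (strip_center_subproof a)) p).

(* The coordinates of the point of the preimage of [z] lying in [J], which is
   unique when [J] is [Xset q b] or [Yset q b] and [z] is on the seam [b]. *)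
Definition preimage_in (J : set (strip_sum (strip q))) (a : strip_index q)
    (z : Z) : R * R :=
  set_val (projT2 (xget (strip_center a) (J `&` [set u | glue q u = z]))).

Variable z : seam_index q -> Z.

Definition edge_path (b : seam_index q) (t : R) : Z :=
  let x := preimage_in (Xset q b) (Xstrip q b) (z b) in
  let y := preimage_in (Yset q b) (Ystrip q b) (z b) in
  if t <= - 2^-1 then
    glue q (strip_point (Xstrip q b) (2 * (1 + t) * x.1, (1 + t) * x.2))
  else if t <= 0 then glue q (strip_point (Xstrip q b) (x.1, (1 + t) * x.2))
  else if t <= 2^-1 then glue q (strip_point (Ystrip q b) (y.1, (1 - t) * y.2))
  else glue q (strip_point (Ystrip q b) (2 * (1 - t) * y.1, (1 - t) * y.2)).

Definition atlas_graph : topologicalType := graph R (Xstrip q) (Ystrip q).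

Definition canonical_map (g : atlas_graph) : Z :=
  match g with
  | Vertex a => glue q (strip_center a)
  | EdgePoint b t => edge_path b (val t)
  end.

Lemma strip_point_center a : strip_point a (0, 0) = strip_center a.
Proof.
congr (existT _ a _); apply: val_inj; rewrite val_insubd.
by rewrite strip_center_subproof.
Qed.

Lemma edge_path_start b : edge_path b (-1) = glue q (strip_center (Xstrip q b)).
Proof.
have e : -1 <= - 2^-1 :> R by lra.
by rewrite /edge_path e subrr mulr0 !mul0r strip_point_center.
Qed.

Lemma edge_path_end b : edge_path b 1 = glue q (strip_center (Ystrip q b)).
Proof.
have [e1 e2 e3] : [/\ (1 <= - 2^-1 :> R) = false, (1 <= 0 :> R) = false &
    (1 <= 2^-1 :> R) = false] 
  by split; apply/negbTE; rewrite -ltNge; lra.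
by rewrite /edge_path e1 e2 e3 subrr mulr0 !mul0r strip_point_center.
Qed.

Lemma canonical_map_edge b t : -1 <= t <= 1 ->
  canonical_map (char_map _ _ b t) = edge_path b t.
Proof.
move=> t1; rewrite /char_map; case: insubP => [s _ <- //|].
rewrite negb_and -!leNgt /= => /orP tout.
have [t0|t0] := leP t 0.
- have -> : t = -1 by case: tout; lra.
  by rewrite edge_path_start.
- have -> : t = 1 by case: tout; lra.
  by rewrite edge_path_end.
Qed.

Lemma strip_point_continuous a :
  {within strip q a, continuous (fun p => glue q (strip_point a p))}.
Proof.
apply/subspace_sigL_continuousP.
have -> : sigL (strip q a) (fun p => glue q (strip_point a p)) =
    glue q \o existT (fun a => strip_space (strip q a)) a.
  apply/funext => u; rewrite /sigL /=; congr (glue q (existT _ a _)).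
  apply: val_inj; rewrite val_insubd /=.
  by case: u => u /= uS; rewrite set_valE /= uS.
move=> u; apply: continuous_comp.
  exact: (@existT_continuous _ (fun a => strip_space (strip q a))).
have [_ oq] := glue_quotient q.
have cq : continuous (glue q) by apply/continuousP => O /oq.
exact: cq.
Qed.

Lemma preimage_inP J a w : (exists2 u, J u & glue q u = w) ->
  exists2 u, J u /\ glue q u = w & preimage_in J a w = set_val (projT2 u).
Proof.
move=> [u Ju uw]; rewrite /preimage_in.
set A := _ `&` _; have Au : A u by [].
by exists (xget (strip_center a) A) => //; exact: (xgetPex _ (ex_intro _ u Au)).
Qed.

Lemma in_strip_point a J u : in_strip a J u ->
  J (set_val (projT2 u)) /\ strip_point a (set_val (projT2 u)) = u.
Proof.
case: u => a' s /= -[/= ea Js]; split => //; subst a'.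
congr (existT _ a _); apply: val_inj; rewrite val_insubd.
by case: s Js => s /= sS _; rewrite set_valE /= sS.
Qed.

Lemma boundary_interval_sub (S J : set (R * R)) :
  boundary_interval S J -> J `<=` strip_boundary S.
Proof. by move=> [p _ ->]; exact: connected_component_sub. Qed.

Hypothesis zP : forall b, seam b (z b).

Lemma preimage_XP b (x := preimage_in (Xset q b) (Xstrip q b) (z b)) :
  [/\ Xitv q b x, strip_boundary (strip q (Xstrip q b)) x &
      glue q (strip_point (Xstrip q b) x) = z b].
Proof.
have [u [/in_strip_point[Ju ue] uz] xE] := preimage_inP (Xstrip q b) (zP b).
rewrite /x xE ue; split => //.
exact: (boundary_interval_sub (Xitv_boundary q b)).
Qed.

Lemma preimage_YP b (y := preimage_in (Yset q b) (Ystrip q b) (z b)) :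
  [/\ Yitv q b y, strip_boundary (strip q (Ystrip q b)) y &
      glue q (strip_point (Ystrip q b) y) = z b].
Proof.
have zY : (glue q @` Yset q b) (z b) by rewrite -(glue_XY q); exact: zP.
have [u [/in_strip_point[Ju ue] uz] yE] := preimage_inP (Ystrip q b) zY.
rewrite /y yE ue; split => //.
exact: (boundary_interval_sub (Yitv_boundary q b)).
Qed.

Lemma ray_in_strip a (x : R * R) s : strip_boundary (strip q a) x ->
  0 <= s < 1 -> forall r, strip q a (r, s * x.2).
Proof.
move=> [_ /= xe] s01 r; apply: (strip_open_sub (stripP q a)) => /=.
by case: xe => ->; lra.
Qed.

Lemma vertical_in_strip a (x : R * R) s : strip_boundary (strip q a) x ->
  0 <= s <= 1 -> strip q a (x.1, s * x.2).
Proof.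
move=> xS s01; have [s1|s1] := ltP s 1.
  by apply: ray_in_strip => //; lra.
have -> : s = 1 by lra.
by rewrite mul1r -surjective_pairing; case: xS.
Qed.

Lemma edge_path_continuous b :
  {within `[(-1 : R), 1], continuous (edge_path b)}.
Proof.
have [_ xS xz] := preimage_XP b; have [_ yS yz] := preimage_YP b.
set x := preimage_in _ _ _ in xS xz; set y := preimage_in _ _ _ in yS yz.
have cpair (f g : R -> R) (D : set R) : continuous f -> continuous g ->
    {within D, continuous (fun t => (f t, g t))}.
  move=> cf cg; apply: continuous_subspaceT => t.
  by apply: (cvg_pair (cf t) (cg t)).
have caff (f : R -> R) c d : (forall t, f t = c + d * t) -> continuous f.
  move=> fE; have -> : f = (fun t => c + d * t) by exact/funext.
  by move=> t; apply: cvgD; [exact: cvg_cst|apply: cvgM; [exact: cvg_cst|exact: cvg_id]].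
pose f1 t := glue q (strip_point (Xstrip q b) (2 * (1 + t) * x.1, (1 + t) * x.2)).
pose f2 t := glue q (strip_point (Xstrip q b) (x.1, (1 + t) * x.2)).
pose f3 t := glue q (strip_point (Ystrip q b) (y.1, (1 - t) * y.2)).
pose f4 t := glue q (strip_point (Ystrip q b) (2 * (1 - t) * y.1, (1 - t) * y.2)).
have c1 : {within `[-1, - 2^-1], continuous f1}.
  apply: (within_comp _ _ (@strip_point_continuous (Xstrip q b))).
  - by move=> t; rewrite /= in_itv /= => t1; apply: ray_in_strip => //; lra.
  - apply: cpair; [apply: (caff _ (2 * x.1) (2 * x.1))|apply: (caff _ x.2 x.2)] => t; ring.
have c2 : {within `[- 2^-1, 0], continuous f2}.
  apply: (within_comp _ _ (@strip_point_continuous (Xstrip q b))).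
  - by move=> t; rewrite /= in_itv /= => t1; apply: vertical_in_strip => //; lra.
  - apply: cpair; first exact: cst_continuous.
    by apply: (caff _ x.2 x.2) => t; ring.
have c3 : {within `[0, 2^-1], continuous f3}.
  apply: (within_comp _ _ (@strip_point_continuous (Ystrip q b))).
  - by move=> t; rewrite /= in_itv /= => t1; apply: vertical_in_strip => //; lra.
  - apply: cpair; first exact: cst_continuous.
    by apply: (caff _ y.2 (- y.2)) => t; ring.
have c4 : {within `[2^-1, 1], continuous f4}.
  apply: (within_comp _ _ (@strip_point_continuous (Ystrip q b))).
  - by move=> t; rewrite /= in_itv /= => t1; apply: ray_in_strip => //; lra.
  - apply: cpair; [apply: (caff _ (2 * y.1) (-2 * y.1))|apply: (caff _ y.2 (- y.2))] => t; ring.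
have e12 : f1 (- 2^-1) = f2 (- 2^-1).
  by rewrite /f1 /f2; congr (glue q (strip_point _ (_, _))); field.
have e34 : f3 2^-1 = f4 2^-1.
  by rewrite /f3 /f4; congr (glue q (strip_point _ (_, _))); field.
have e23 : f2 0 = f3 0.
  rewrite /f2 /f3 addr0 subr0 !mul1r -!surjective_pairing.
  by rewrite xz yz.
pose g1 t := if t <= - 2^-1 then f1 t else f2 t.
pose g2 t := if t <= 2^-1 then f3 t else f4 t.
have d1 : {within `[-1, 0], continuous g1}.
  apply: (within_paste _ _ _ _ _ c1 c2); try exact: interval_closed.
  - move=> t /=; rewrite !in_itv /= => t1.
    by have [t0|t0] := leP t (- 2^-1); [left|right]; lra.
  - by move=> t; rewrite /= in_itv /= /g1 => /andP[_ ->].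
  - move=> t; rewrite /= in_itv /= /g1 => /andP[t1 _].
    case: ifP => // t2; have -> : t = - 2^-1 by lra.
    exact: e12.
have d2 : {within `[0, 1], continuous g2}.
  apply: (within_paste _ _ _ _ _ c3 c4); try exact: interval_closed.
  - move=> t /=; rewrite !in_itv /= => t1.
    by have [t0|t0] := leP t 2^-1; [left|right]; lra.
  - by move=> t; rewrite /= in_itv /= /g2 => /andP[_ ->].
  - move=> t; rewrite /= in_itv /= /g2 => /andP[t1 _].
    case: ifP => // t2; have -> : t = 2^-1 by lra.
    exact: e34.
apply: (within_paste _ _ _ _ _ d1 d2); try exact: interval_closed.
- move=> t /=; rewrite !in_itv /= => t1.
  by have [t0|t0] := leP t 0; [left|right]; lra.
- move=> t; rewrite /= in_itv /= /edge_path /g1 -/x -/y => /andP[_ t0].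
  by case: ifP => //; rewrite t0.
- move=> t; rewrite /= in_itv /= /edge_path /g2 -/x -/y => /andP[t0 _].
  have -> : (t <= - 2^-1) = false by apply/negbTE; rewrite -ltNge; lra.
  case: ifP => // t1; have -> : t = 0 by lra.
  have -> : 0 <= 2^-1 :> R by lra.
  exact: e23.
Qed.

Theorem canonical_map_continuous : continuous canonical_map.
Proof.
apply: graph_continuous => b; apply: (within_eq _ (@edge_path_continuous b)).
by move=> t; rewrite /= in_itv /= => t1; rewrite canonical_map_edge.
Qed.

End CanonicalMap.
Arguments canonical_map {R Z q} z g.
Arguments canonical_map_continuous {R Z q z}.

(* Single-sorted presentation: [gcomp f g] is [f] followed by [g], defined when
   the target of [f] is the source of [g]. *)
Record groupoid := Groupoid {
  obj : Type;
  arr : Type;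
  source : arr -> obj;
  target : arr -> obj;
  gid : obj -> arr;
  gcomp : forall f g : arr, target f = source g -> arr;
  ginv : arr -> arr;
  gid_source : forall x, source (gid x) = x;
  gid_target : forall x, target (gid x) = x;
  gcomp_source : forall f g e, source (@gcomp f g e) = source f;
  gcomp_target : forall f g e, target (@gcomp f g e) = target g;
  ginv_source : forall f, source (ginv f) = target f;
  ginv_target : forall f, target (ginv f) = source f;
  gcompA : forall f g h efg egh e1 e2,
    @gcomp f (@gcomp g h egh) e1 = @gcomp (@gcomp f g efg) h e2;
  gcomp1g : forall f e, @gcomp (gid (source f)) f e = f;
  gcompg1 : forall f e, @gcomp f (gid (target f)) e = f;
  gcompgV : forall f e, @gcomp f (ginv f) e = gid (source f);
  gcompVg : forall f e, @gcomp (ginv f) f e = gid (target f) }.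

Record groupoid_morphism (C D : groupoid) := GroupoidMorphism {
  fobj : obj C -> obj D;
  farr : arr C -> arr D;
  farr_source : forall f, source (farr f) = fobj (source f);
  farr_target : forall f, target (farr f) = fobj (target f);
  farr_id : forall x, farr (gid x) = gid (fobj x);
  farr_comp : forall (f g : arr C) e e',
    farr (@gcomp C f g e) = @gcomp D (farr f) (farr g) e' }.

Definition groupoid_isomorphism (C D : groupoid) (F : groupoid_morphism C D) :=
  exists G : groupoid_morphism D C,
    [/\ cancel (fobj F) (fobj G), cancel (fobj G) (fobj F),
        cancel (farr F) (farr G) & cancel (farr G) (farr F)].

Section Paths.
Variables (R : realType) (W : topologicalType).
Implicit Types p q r : R -> W.

Definition continuous_path p := {within `[(0 : R), 1], continuous p}.

(* [H (t, s)]: [t] is the path parameter, [s] the homotopy parameter. *)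
Definition path_homotopic p q := exists H : R * R -> W,
  [/\ {within `[(0 : R), 1] `*` `[(0 : R), 1], continuous H},
      forall t : R, 0 <= t <= 1 -> H (t, 0) = p t,
      forall t : R, 0 <= t <= 1 -> H (t, 1) = q t,
      forall s : R, 0 <= s <= 1 -> H (0, s) = p 0 &
      forall s : R, 0 <= s <= 1 -> H (1, s) = p 1].

Definition concat p q (t : R) : W :=
  if t <= 2^-1 then p (2 * t) else q (2 * t - 1).

Definition reverse p (t : R) : W := p (1 - t).

Definition path_connected_to (x y : W) :=
  exists p, [/\ continuous_path p, p 0 = x & p 1 = y].

(* The condition making [W'] a legitimate set of base points: [Pi1 R W'] is then
   equivalent to the whole fundamental groupoid of [W]. *)
Definition meets_all_path_components (W' : set W) :=
  forall w, exists2 w', W' w' & path_connected_to w w'.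

Lemma continuous_path_comp p (a : R -> R) : continuous_path p ->
  {within `[(0 : R), 1], continuous a} ->
  (forall t, 0 <= t <= 1 -> 0 <= a t <= 1) ->
  continuous_path (fun t => p (a t)).
Proof.
by move=> cp ca a01; apply: (within_comp _ ca cp) => t; rewrite /= !in_itv /=; exact: a01.
Qed.

Lemma affine_continuous (f : R -> R) c d :
  (forall t, f t = c + d * t) -> continuous f.
Proof.
move=> fE; have -> : f = (fun t => c + d * t) by exact/funext.
by move=> t; apply: cvgD; [exact: cvg_cst|apply: cvgM; [exact: cvg_cst|exact: cvg_id]].
Qed.

Lemma concat_continuous p q : continuous_path p -> continuous_path q ->
  p 1 = q 0 -> continuous_path (concat p q).
Proof.
move=> cp cq pq.
have c1 : {within `[(0 : R), 2^-1], continuous (fun t => p (2 * t))}.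
  apply: (within_comp _ _ cp).
  - by move=> t; rewrite /= !in_itv /=; lra.
  - by apply: continuous_subspaceT; apply: (@affine_continuous _ 0 2) => t; ring.
have c2 : {within `[(2^-1 : R), 1], continuous (fun t => q (2 * t - 1))}.
  apply: (within_comp _ _ cq).
  - by move=> t; rewrite /= !in_itv /=; lra.
  - by apply: continuous_subspaceT; apply: (@affine_continuous _ (-1) 2) => t; ring.
apply: (within_paste _ _ _ _ _ c1 c2); try exact: interval_closed.
- move=> t; rewrite /= !in_itv /= => t1.
  by have [t0|t0] := leP t 2^-1; [left|right]; lra.
- by move=> t; rewrite /= in_itv /= /concat => /andP[_ ->].
- move=> t; rewrite /= in_itv /= /concat => /andP[t1 _].
  case: ifP => // t2; have -> : t = 2^-1 by lra.
  by rewrite divff// subrr.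
Qed.

Lemma concat0 p q : concat p q 0 = p 0.
Proof.
have h : 0 <= 2^-1 :> R by lra.
by rewrite /concat h mulr0.
Qed.

Lemma concat1 p q : concat p q 1 = q 1.
Proof.
have h : (1 <= 2^-1 :> R) = false by apply/negbTE; rewrite -ltNge; lra.
by rewrite /concat h; congr q; ring.
Qed.

Lemma reverse_continuous p : continuous_path p -> continuous_path (reverse p).
Proof.
move=> cp; apply: continuous_path_comp => //; last by move=> t; lra.
by apply: continuous_subspaceT; apply: (@affine_continuous _ 1 (-1)) => t; ring.
Qed.

Lemma path_homotopic_ends p q : path_homotopic p q -> p 0 = q 0 /\ p 1 = q 1.
Proof.
have h0 : 0 <= (0 : R) <= 1 by rewrite ?lexx ler01.
have h1 : 0 <= (1 : R) <= 1 by rewrite ?lexx ler01.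
move=> [H [_ _ H1 H2 H3]].
by rewrite -(H1 0)// -(H1 1)// H2 ?H3.
Qed.

Lemma unit_square (t s : R) : (`[(0 : R), 1] `*` `[(0 : R), 1]) (t, s) <->
  0 <= t <= 1 /\ 0 <= s <= 1.
Proof. by rewrite /= !in_itv. Qed.

Lemma square_comp (D : set (R * R)) (H : R * R -> W) (a b : R * R -> R) :
  {within `[(0 : R), 1] `*` `[(0 : R), 1], continuous H} ->
  continuous a -> continuous b ->
  (forall x, D x -> 0 <= a x <= 1 /\ 0 <= b x <= 1) ->
  {within D, continuous (fun x => H (a x, b x))}.
Proof.
move=> cH ca cb Dab; apply: (within_comp (B := `[(0 : R), 1] `*` `[(0 : R), 1]) _ _ cH).
- by move=> x /Dab; rewrite unit_square.
- by apply: continuous_subspaceT => x; exact: (cvg_pair (ca x) (cb x)).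
Qed.

Lemma fst_continuous : continuous (fun x : R * R => x.1).
Proof. by move=> x; exact: cvg_fst. Qed.

Lemma snd_continuous : continuous (fun x : R * R => x.2).
Proof. by move=> x; exact: cvg_snd. Qed.

Lemma affine_comp_continuous (f : R * R -> R) (c d : R) : continuous f ->
  continuous (fun x => c + d * f x).
Proof.
move=> cf x; apply: cvgD; first exact: cvg_cst.
by apply: cvgM; [exact: cvg_cst|exact: cf].
Qed.

Lemma square_paste (D A B : set (R * R)) (f g h : R * R -> W) :
  closed A -> closed B -> D `<=` A `|` B ->
  (forall x, D x -> A x -> h x = f x) -> (forall x, D x -> B x -> h x = g x) ->
  closed D ->
  {within A `&` D, continuous f} -> {within B `&` D, continuous g} ->
  {within D, continuous h}.
Proof.
move=> cA cB DAB hf hg cD; apply: within_paste.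
- exact: closedI.
- exact: closedI.
- by move=> x Dx; case: (DAB _ Dx) => ?; [left|right].
- by move=> x [Ax Dx]; exact: hf.
- by move=> x [Bx Dx]; exact: hg.
Qed.

Lemma closed_square : closed (`[(0 : R), 1] `*` `[(0 : R), 1]).
Proof.
have -> : `[(0 : R), 1] `*` `[(0 : R), 1] =
    (fun x : R * R => x.1) @^-1` `[0, 1] `&` (fun x : R * R => x.2) @^-1` `[0, 1].
  by [].
apply: closedI; apply: preimage_closed; try by exact: interval_closed.
- by move=> x _; exact: fst_continuous.
- by move=> x _; exact: snd_continuous.
Qed.

Lemma closed_le_half (f : R * R -> R) : continuous f ->
  closed [set x | f x <= 2^-1].
Proof.
by move=> cf; apply: (@preimage_closed _ _ f [set y | y <= 2^-1]); [move=> x _; exact: cf|exact: closed_le].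
Qed.

Lemma closed_ge_half (f : R * R -> R) : continuous f ->
  closed [set x | 2^-1 <= f x].
Proof.
by move=> cf; apply: (@preimage_closed _ _ f [set y | 2^-1 <= y]); [move=> x _; exact: cf|exact: closed_ge].
Qed.

Lemma path_homotopic_refl p : continuous_path p -> path_homotopic p p.
Proof.
move=> cp; exists (fun x => p x.1); split => //.
apply: (within_comp _ _ cp) => [x|]; first by case.
by apply: continuous_subspaceT; exact: fst_continuous.
Qed.

Lemma path_homotopic_sym p q : path_homotopic p q -> path_homotopic q p.
Proof.
move=> pq; have [e0 e1] := path_homotopic_ends pq.
have [H [cH H0 H1 H2 H3]] := pq.
exists (fun x => H (x.1, 1 + (-1) * x.2)); split.
- apply: square_comp => //; first exact: fst_continuous.
  + exact: (affine_comp_continuous snd_continuous).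
  + by move=> [t s] /unit_square /=; lra.
- by move=> t t01 /=; rewrite mulr0 addr0 H1.
- by move=> t t01 /=; rewrite mulr1 subrr H0.
- by move=> s s01 /=; rewrite H2 ?e0//; lra.
- by move=> s s01 /=; rewrite H3 ?e1//; lra.
Qed.

Lemma path_homotopic_trans q p r :
  path_homotopic p q -> path_homotopic q r -> path_homotopic p r.
Proof.
move=> pq; have [e0 e1] := path_homotopic_ends pq.
have [H [cH H0 H1 H2 H3]] := pq.
move=> [K [cK K0 K1 K2 K3]].
have i0 : 0 <= (0 : R) <= 1 by rewrite ?lexx ler01.
have i1 : 0 <= (1 : R) <= 1 by rewrite ?lexx ler01.
exists (fun x => if x.2 <= 2^-1 then H (x.1, 0 + 2 * x.2) else K (x.1, -1 + 2 * x.2)).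
split.
- apply: (square_paste (closed_le_half snd_continuous) (closed_ge_half snd_continuous)
    (f := fun x => H (x.1, 0 + 2 * x.2)) (g := fun x => K (x.1, -1 + 2 * x.2))).
  + by move=> x _ /=; have [?|/ltW ?] := leP x.2 2^-1; [left|right].
  + by move=> x _ /= ->.
  + move=> [t s] /unit_square/= [t01 s01] s2; case: ifP => // s3.
    have -> : s = 2^-1 by lra.
    have -> : 0 + 2 / 2 = 1 :> R by field.
    have -> : -1 + 2 / 2 = 0 :> R by field.
    by rewrite H1 // K0.
  + exact: closed_square.
  + apply: square_comp => //; first exact: fst_continuous.
    * exact: (affine_comp_continuous snd_continuous).
    * by move=> [t s] [/= s2 /unit_square]; lra.
  + apply: square_comp => //; first exact: fst_continuous.
    * exact: (affine_comp_continuous snd_continuous).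
    * by move=> [t s] [/= s2 /unit_square]; lra.
- move=> t t01 /=; have -> : 0 <= 2^-1 :> R by lra.
  by rewrite mulr0 addr0 H0.
- move=> t t01 /=; have -> : (1 <= 2^-1 :> R) = false by apply/negbTE; rewrite -ltNge; lra.
  by rewrite -K1 //; congr (K (_, _)); ring.
- move=> s s01 /=; have [s2|s2] := leP s 2^-1.
  + by rewrite H2//; lra.
  + by rewrite K2 ?e0//; lra.
- move=> s s01 /=; have [s2|s2] := leP s 2^-1.
  + by rewrite H3//; lra.
  + by rewrite K3 ?e1//; lra.
Qed.

Lemma concat_homotopic p p' q q' : p 1 = q 0 ->
  path_homotopic p p' -> path_homotopic q q' ->
  path_homotopic (concat p q) (concat p' q').
Proof.
move=> pq [H [cH H0 H1 H2 H3]] [K [cK K0 K1 K2 K3]].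
exists (fun x => if x.1 <= 2^-1 then H (0 + 2 * x.1, x.2) else K (-1 + 2 * x.1, x.2)).
split.
- apply: (square_paste (closed_le_half fst_continuous) (closed_ge_half fst_continuous)
    (f := fun x => H (0 + 2 * x.1, x.2)) (g := fun x => K (-1 + 2 * x.1, x.2))).
  + by move=> x _ /=; have [?|/ltW ?] := leP x.1 2^-1; [left|right].
  + by move=> x _ /= ->.
  + move=> [t s] /unit_square/= [t01 s01] s2; case: ifP => // s3.
    have -> : t = 2^-1 by lra.
    have -> : 0 + 2 / 2 = 1 :> R by field.
    have -> : -1 + 2 / 2 = 0 :> R by field.
    by rewrite H3 // K2.
  + exact: closed_square.
  + apply: square_comp => //; last 1 first.
    * by move=> [t s] [/= s2 /unit_square]; lra.
    * exact: (affine_comp_continuous fst_continuous).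
    * exact: snd_continuous.
  + apply: square_comp => //; last 1 first.
    * by move=> [t s] [/= s2 /unit_square]; lra.
    * exact: (affine_comp_continuous fst_continuous).
    * exact: snd_continuous.
- move=> t t01 /=; rewrite /concat; have [t2|t2] := leP t 2^-1.
  + by rewrite H0 ?add0r//; lra.
  + by rewrite K0 1?addrC//; lra.
- move=> t t01 /=; rewrite /concat; have [t2|t2] := leP t 2^-1.
  + by rewrite H1 ?add0r//; lra.
  + by rewrite K1 1?addrC//; lra.
- move=> s s01 /=; have -> : 0 <= 2^-1 :> R by lra.
  by rewrite mulr0 addr0 concat0 H2.
- move=> s s01 /=; have -> : (1 <= 2^-1 :> R) = false by apply/negbTE; rewrite -ltNge; lra.
  have -> : -1 + 2 * 1 = 1 :> R by ring.
  by rewrite concat1 K3.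
Qed.

Lemma reverse_homotopic p q :
  path_homotopic p q -> path_homotopic (reverse p) (reverse q).
Proof.
move=> [H [cH H0 H1 H2 H3]].
exists (fun x => H (1 + (-1) * x.1, x.2)); split.
- apply: square_comp => //; last 1 first.
  + by move=> [t s] /unit_square /=; lra.
  + exact: (affine_comp_continuous fst_continuous).
  + exact: snd_continuous.
- by move=> t t01 /=; rewrite mulN1r H0//; lra.
- by move=> t t01 /=; rewrite mulN1r H1//; lra.
- by move=> s s01 /=; rewrite mulr0 addr0 H3// /reverse subr0.
- by move=> s s01 /=; rewrite mulr1 subrr H2// /reverse subrr.
Qed.

Lemma reparam_homotopic p (a b : R -> R) : continuous_path p ->
  continuous a -> continuous b ->
  (forall t, 0 <= t <= 1 -> 0 <= a t <= 1) ->
  (forall t, 0 <= t <= 1 -> 0 <= b t <= 1) ->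
  a 0 = b 0 -> a 1 = b 1 ->
  path_homotopic (fun t => p (a t)) (fun t => p (b t)).
Proof.
move=> cp ca cb a01 b01 ab0 ab1.
exists (fun x => p ((1 - x.2) * a x.1 + x.2 * b x.1)); split.
- apply: (within_comp _ _ cp).
  + move=> [t s] /unit_square /= [t01 s01]; rewrite in_itv /=.
    by have := a01 _ t01; have := b01 _ t01; nra.
  + apply: continuous_subspaceT => x; apply: cvgD; apply: cvgM.
    * by apply: cvgB; [exact: cvg_cst|exact: cvg_snd].
    * by apply: (cvg_comp _ _ (@fst_continuous x)); exact: ca.
    * exact: cvg_snd.
    * by apply: (cvg_comp _ _ (@fst_continuous x)); exact: cb.
- by move=> t t01 /=; congr p; ring.
- by move=> t t01 /=; congr p; ring.
- by move=> s s01 /=; rewrite -ab0; congr p; ring.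
- by move=> s s01 /=; rewrite -ab1; congr p; ring.
Qed.

Lemma path_homotopic_eq p p' q : (forall t, 0 <= t <= 1 -> p t = p' t) ->
  path_homotopic p q -> path_homotopic p' q.
Proof.
move=> pp' [H [cH H0 H1 H2 H3]]; exists H; split => //.
- by move=> t t01; rewrite H0// pp'.
- by move=> s s01; rewrite H2// pp'//; lra.
- by move=> s s01; rewrite H3// pp'//; lra.
Qed.

Lemma path_homotopic_reparam p q (a : R -> R) : continuous_path q ->
  continuous a -> (forall t, 0 <= t <= 1 -> 0 <= a t <= 1) ->
  a 0 = 0 -> a 1 = 1 -> (forall t, 0 <= t <= 1 -> p t = q (a t)) ->
  path_homotopic p q.
Proof.
move=> cq ca a01 a0 a1 pq.
apply: (@path_homotopic_eq (fun t => q (a t))); first by move=> t /pq.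
exact: (@reparam_homotopic q a id cq ca (fun x => @cvg_id _ _)).
Qed.

Lemma min_continuous (f g : R -> R) : continuous f -> continuous g ->
  continuous (fun t => Num.min (f t) (g t)).
Proof. by move=> cf cg t; apply: continuous_min; [exact: cf|exact: cg]. Qed.

Lemma max_continuous (f g : R -> R) : continuous f -> continuous g ->
  continuous (fun t => Num.max (f t) (g t)).
Proof. by move=> cf cg t; apply: continuous_max; [exact: cf|exact: cg]. Qed.

Lemma concatA_homotopic p q r : continuous_path p -> continuous_path q ->
  continuous_path r -> p 1 = q 0 -> q 1 = r 0 ->
  path_homotopic (concat (concat p q) r) (concat p (concat q r)).
Proof.
move=> cp cq cr pq qr.
pose a t : R := Num.min (2 * t) (Num.min (t + 4^-1) (2^-1 + 2^-1 * t)).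
have aE t : 0 <= t <= 1 -> a t =
    if t <= 4^-1 then 2 * t else if t <= 2^-1 then t + 4^-1 else 2^-1 + 2^-1 * t.
  move=> t01; rewrite /a /Num.min.
  by case: ifP => h1; case: ifP => h2; move: h1 h2; do ?case: ifP; lra.
apply: (@path_homotopic_reparam _ _ a).
- by apply: concat_continuous => //; [exact: concat_continuous|rewrite concat0].
- apply: min_continuous; last apply: min_continuous.
  + by apply: (@affine_continuous _ 0 2) => t; ring.
  + by apply: (@affine_continuous _ 4^-1 1) => t; ring.
  + by apply: (@affine_continuous _ 2^-1 2^-1).
- by move=> t t01; rewrite aE //; do ?case: ifP; lra.
- by rewrite aE; do ?case: ifP; lra.
- by rewrite aE; do ?case: ifP; lra.
- move=> t t01; rewrite aE // /concat.
  have [t4|t4] := leP t 4^-1.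
    have -> : t <= 2^-1 by lra.
    have -> : 2 * t <= 2^-1 by lra.
    by [].
  have [t2|t2] := leP t 2^-1.
    have -> : (2 * t <= 2^-1) = false by apply/negbTE; rewrite -ltNge; lra.
    have -> : (t + 4^-1 <= 2^-1) = false by apply/negbTE; rewrite -ltNge; lra.
    have -> : 2 * (t + 4^-1) - 1 <= 2^-1 by lra.
    by congr q; field.
  have -> : (2^-1 + 2^-1 * t <= 2^-1) = false by apply/negbTE; rewrite -ltNge; lra.
  have -> : (2 * (2^-1 + 2^-1 * t) - 1 <= 2^-1) = false by apply/negbTE; rewrite -ltNge; lra.
  by congr r; field.
Qed.

Lemma concat1p_homotopic p : continuous_path p ->
  path_homotopic (concat (cst (p 0)) p) p.
Proof.
move=> cp; pose a t : R := Num.max 0 (2 * t - 1).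
have aE t : a t = if t <= 2^-1 then 0 else 2 * t - 1.
  by rewrite /a /Num.max; do ?case: ifP; lra.
apply: (@path_homotopic_reparam _ _ a) => //.
- apply: max_continuous; first exact: cst_continuous.
  by apply: (@affine_continuous _ (-1) 2) => t; ring.
- by move=> t t01; rewrite aE; case: ifP; lra.
- by rewrite aE; case: ifP; lra.
- by rewrite aE; case: ifP; lra.
- by move=> t t01; rewrite aE /concat; case: ifP.
Qed.

Lemma concatp1_homotopic p : continuous_path p ->
  path_homotopic (concat p (cst (p 1))) p.
Proof.
move=> cp; pose a t : R := Num.min 1 (2 * t).
have aE t : a t = if t <= 2^-1 then 2 * t else 1.
  by rewrite /a /Num.min; do ?case: ifP; lra.
apply: (@path_homotopic_reparam _ _ a) => //.
- apply: min_continuous; first exact: cst_continuous.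
  by apply: (@affine_continuous _ 0 2) => t; ring.
- by move=> t t01; rewrite aE; case: ifP; lra.
- by rewrite aE; case: ifP; lra.
- by rewrite aE; case: ifP; lra.
- by move=> t t01; rewrite aE /concat; case: ifP.
Qed.

Lemma concat_reverse_homotopic p : continuous_path p ->
  path_homotopic (concat p (reverse p)) (cst (p 0)).
Proof.
move=> cp; pose a t : R := Num.min (2 * t) (2 - 2 * t).
have aE t : a t = if t <= 2^-1 then 2 * t else 2 - 2 * t.
  by rewrite /a /Num.min; do ?case: ifP; lra.
apply: (@path_homotopic_eq (fun t => p (a t))).
  move=> t t01; rewrite aE /concat /reverse; case: ifP => // _.
  by congr p; ring.
apply: (@reparam_homotopic p a (cst 0)) => //.
- apply: min_continuous.
    by apply: (@affine_continuous _ 0 2) => t; ring.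
  by apply: (@affine_continuous _ 2 (-2)) => t; ring.
- exact: cst_continuous.
- by move=> t t01; rewrite aE; case: ifP; lra.
- by move=> t t01 /=; lra.
- by rewrite aE /=; case: ifP; lra.
- by rewrite aE /=; case: ifP; lra.
Qed.

End Paths.

Lemma map_homotopic (R : realType) (W V : topologicalType) (f : W -> V)
    (p q : R -> W) : continuous f -> path_homotopic p q ->
  path_homotopic (fun t => f (p t)) (fun t => f (q t)).
Proof.
move=> cf [H [cH H0 H1 H2 H3]]; exists (fun x => f (H x)); split.
- apply: (within_comp (B := setT) _ cH) => //.
  by apply: continuous_subspaceT.
- by move=> t t01; rewrite H0.
- by move=> t t01; rewrite H1.
- by move=> s s01; rewrite H2.
- by move=> s s01; rewrite H3.
Qed.

Record based_path (R : realType) (W : topologicalType) (W' : set W) :=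
  BasedPath {
    path_fun :> R -> W;
    path_fun_continuous : continuous_path path_fun;
    path_fun_source : path_fun 0 \in W';
    path_fun_target : path_fun 1 \in W' }.

Arguments path_fun_continuous {R W W'}.

HB.instance Definition _ R W W' := gen_eqMixin (@based_path R W W').
HB.instance Definition _ R W W' := gen_choiceMixin (@based_path R W W').

Section Pi1.
Variables (R : realType) (W : topologicalType) (W' : set W).
Local Notation bpath := (@based_path R W W').
Implicit Types p q : bpath.

Definition path_rel : rel bpath := fun p q => `[< path_homotopic p q >].

Lemma path_rel_refl : reflexive path_rel.
Proof. by move=> p; apply/asboolP/path_homotopic_refl/path_fun_continuous. Qed.

Lemma path_rel_sym : symmetric path_rel.
Proof. by move=> p q; apply/idP/idP => /asboolP/path_homotopic_sym/asboolP. Qed.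

Lemma path_rel_trans : transitive path_rel.
Proof.
by move=> q p r /asboolP pq /asboolP qr; apply/asboolP/(path_homotopic_trans pq).
Qed.

Canonical path_equiv := EquivRel path_rel path_rel_refl path_rel_sym path_rel_trans.

Definition path_class := {eq_quot path_equiv}.

Lemma path_class_eqP p q :
  \pi_path_class p = \pi_path_class q <-> path_homotopic p q.
Proof. by split=> [/eqmodP/asboolP|pq]; last by apply/eqmodP/asboolP. Qed.

Lemma repr_homotopic p : path_homotopic (repr (\pi_path_class p)) p.
Proof. by apply/path_class_eqP; rewrite reprK. Qed.

Definition path_source p : set_type W' := SigSub (path_fun_source p).
Definition path_target p : set_type W' := SigSub (path_fun_target p).

Definition class_source (c : path_class) := path_source (repr c).
Definition class_target (c : path_class) := path_target (repr c).

Lemma class_sourceE p : class_source (\pi_path_class p) = path_source p.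
Proof. by apply: val_inj; have [] := path_homotopic_ends (repr_homotopic p). Qed.

Lemma class_targetE p : class_target (\pi_path_class p) = path_target p.
Proof. by apply: val_inj; have [] := path_homotopic_ends (repr_homotopic p). Qed.

Definition id_path (x : set_type W') : bpath :=
  @BasedPath R W W' (cst (val x)) (continuous_subspaceT (@cst_continuous _ _ _))
    (valP x) (valP x).

Lemma path_compat p q : path_target p = path_source q -> p 1 = q 0.
Proof. by move=> /(congr1 val). Qed.

Lemma concat_source p q : concat p q 0 \in W'.
Proof. by rewrite concat0 path_fun_source. Qed.

Lemma concat_target p q : concat p q 1 \in W'.
Proof. by rewrite concat1 path_fun_target. Qed.

Definition concat_path p q (e : path_target p = path_source q) : bpath :=
  BasedPath (concat_continuous (path_fun_continuous p) (path_fun_continuous q)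
    (path_compat e)) (concat_source p q) (concat_target p q).

Lemma reverse_source p : reverse p 0 \in W'.
Proof. by rewrite /reverse subr0 path_fun_target. Qed.

Lemma reverse_target p : reverse p 1 \in W'.
Proof. by rewrite /reverse subrr path_fun_source. Qed.

Definition reverse_path p : bpath :=
  BasedPath (reverse_continuous (path_fun_continuous p))
    (reverse_source p) (reverse_target p).

Definition class_id (x : set_type W') : path_class := \pi_path_class (id_path x).

Definition class_comp (c d : path_class) (e : class_target c = class_source d) :
  path_class := \pi_path_class (concat_path e).

Definition class_inv (c : path_class) : path_class := \pi_path_class (reverse_path (repr c)).

Lemma class_compE p q e e' :
  @class_comp (\pi_path_class p) (\pi_path_class q) e = \pi_path_class (@concat_path p q e').
Proof.
apply/path_class_eqP; apply: concat_homotopic; last 2 first.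
- exact: repr_homotopic.
- exact: repr_homotopic.
exact: path_compat e.
Qed.

Lemma class_invE p : class_inv (\pi_path_class p) = \pi_path_class (reverse_path p).
Proof. by apply/path_class_eqP; apply: reverse_homotopic; exact: repr_homotopic. Qed.

Lemma class_id_source x : class_source (class_id x) = x.
Proof. by rewrite class_sourceE; exact: val_inj. Qed.

Lemma class_id_target x : class_target (class_id x) = x.
Proof. by rewrite class_targetE; exact: val_inj. Qed.

Lemma class_comp_source c d e : class_source (@class_comp c d e) = class_source c.
Proof. by rewrite class_sourceE; apply: val_inj; exact: concat0. Qed.

Lemma class_comp_target c d e : class_target (@class_comp c d e) = class_target d.
Proof. by rewrite class_targetE; apply: val_inj; exact: concat1. Qed.

Lemma class_inv_source c : class_source (class_inv c) = class_target c.
Proof. by rewrite class_sourceE; apply: val_inj; rewrite /= /reverse subr0. Qed.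

Lemma class_inv_target c : class_target (class_inv c) = class_source c.
Proof. by rewrite class_targetE; apply: val_inj; rewrite /= /reverse subrr. Qed.

Lemma class_compA c d f ecd edf e1 e2 :
  @class_comp c (@class_comp d f edf) e1 = @class_comp (@class_comp c d ecd) f e2.
Proof.
have pcd := path_compat ecd; have pdf := path_compat edf.
have [cc cd cf] : [/\ continuous_path (repr c), continuous_path (repr d) &
    continuous_path (repr f)] by split; exact: path_fun_continuous.
apply/path_class_eqP.
apply: (@path_homotopic_trans _ _ (concat (repr c) (concat (repr d) (repr f)))).
  apply: concat_homotopic; first exact: (path_compat e1).
    exact: path_homotopic_refl.
  exact: repr_homotopic.
apply: (path_homotopic_trans (path_homotopic_sym (concatA_homotopic cc cd cf pcd pdf))).
apply: concat_homotopic; first by rewrite concat1.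
  exact: path_homotopic_sym (repr_homotopic (concat_path ecd)).
exact: path_homotopic_refl.
Qed.

Lemma class_comp1c c e : @class_comp (class_id (class_source c)) c e = c.
Proof.
rewrite -[RHS]reprK; apply/path_class_eqP.
apply: (path_homotopic_trans _ (concat1p_homotopic (path_fun_continuous (repr c)))).
apply: concat_homotopic; first exact: (path_compat e).
  exact: repr_homotopic.
exact/path_homotopic_refl/path_fun_continuous.
Qed.

Lemma class_compc1 c e : @class_comp c (class_id (class_target c)) e = c.
Proof.
rewrite -[RHS]reprK; apply/path_class_eqP.
apply: (path_homotopic_trans _ (concatp1_homotopic (path_fun_continuous (repr c)))).
apply: concat_homotopic; first exact: (path_compat e).
  exact/path_homotopic_refl/path_fun_continuous.
exact: repr_homotopic.
Qed.

Lemma class_compcV c e : @class_comp c (class_inv c) e = class_id (class_source c).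
Proof.
apply/path_class_eqP.
apply: (path_homotopic_trans _ (concat_reverse_homotopic (path_fun_continuous (repr c)))).
apply: concat_homotopic; first exact: (path_compat e).
  exact/path_homotopic_refl/path_fun_continuous.
exact: repr_homotopic.
Qed.

Lemma class_compVc c e : @class_comp (class_inv c) c e = class_id (class_target c).
Proof.
have cr := path_fun_continuous (reverse_path (repr c)).
apply/path_class_eqP.
have -> : path_fun (id_path (class_target c)) = cst (reverse (repr c) 0).
  by apply/funext => t; rewrite /= /reverse subr0.
apply: (path_homotopic_trans _ (concat_reverse_homotopic cr)).
have -> : reverse (reverse_path (repr c)) = repr c.
  by apply/funext => t; rewrite /reverse /= /reverse subKr.
apply: concat_homotopic; first exact: (path_compat e).
  exact: repr_homotopic.
exact/path_homotopic_refl/path_fun_continuous.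
Qed.

Definition Pi1 : groupoid :=
  Groupoid class_id_source class_id_target class_comp_source class_comp_target
    class_inv_source class_inv_target class_compA class_comp1c class_compc1
    class_compcV class_compVc.

End Pi1.
Arguments Pi1 R {W} W'.

Section Pi1Map.
Variables (R : realType) (W V : topologicalType) (f : W -> V).
Hypothesis cf : continuous f.
Variables (W' : set W) (V' : set V).
Hypothesis fW : W' `<=` f @^-1` V'.

Lemma map_base_subproof w : w \in W' -> f w \in V'.
Proof. by move=> /set_mem/fW/mem_set. Qed.

Definition map_base (x : set_type W') : set_type V' :=
  SigSub (map_base_subproof (valP x)).

Lemma map_path_continuous (p : based_path R W') :
  continuous_path (fun t => f (p t)).
Proof.
apply: (within_comp (B := setT) _ (path_fun_continuous p)) => //.
exact: continuous_subspaceT.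
Qed.

Definition map_path (p : based_path R W') : based_path R V' :=
  BasedPath (@map_path_continuous p) (map_base_subproof (path_fun_source p))
    (map_base_subproof (path_fun_target p)).

Definition map_class (c : path_class R W') : path_class R V' :=
  \pi_(path_class R V') (map_path (repr c)).

Lemma map_classE p : map_class (\pi_(path_class R W') p) = \pi_(path_class R V') (map_path p).
Proof. by apply/path_class_eqP; apply: map_homotopic cf _; exact: repr_homotopic. Qed.

Lemma map_class_source c : class_source (map_class c) = map_base (class_source c).
Proof. by rewrite class_sourceE; exact: val_inj. Qed.

Lemma map_class_target c : class_target (map_class c) = map_base (class_target c).
Proof. by rewrite class_targetE; exact: val_inj. Qed.

Lemma map_class_id x : map_class (class_id R x) = class_id R (map_base x).
Proof.
rewrite map_classE; apply/path_class_eqP.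
exact/path_homotopic_refl/path_fun_continuous.
Qed.

Lemma map_class_comp c d e e' :
  map_class (@class_comp R W W' c d e) = class_comp (c := map_class c) (d := map_class d) e'.
Proof.
rewrite map_classE; apply/path_class_eqP.
apply: (@path_homotopic_trans _ _ (concat (fun t => f (repr c t)) (fun t => f (repr d t)))).
  have -> : concat (fun t => f (repr c t)) (fun t => f (repr d t)) =
      path_fun (map_path (concat_path e)).
    by apply/funext => t; rewrite /= /concat; case: ifP.
  exact/path_homotopic_refl/path_fun_continuous.
apply: concat_homotopic; first by rewrite (path_compat e).
  exact: path_homotopic_sym (repr_homotopic (map_path (repr c))).
exact: path_homotopic_sym (repr_homotopic (map_path (repr d))).
Qed.

Definition Pi1_map : groupoid_morphism (Pi1 R W') (Pi1 R V') :=
  @GroupoidMorphism (Pi1 R W') (Pi1 R V') map_base map_class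
    map_class_source map_class_target map_class_id map_class_comp.

End Pi1Map.
Arguments Pi1_map R {W V f} cf {W' V'} fW.

(* Main.v *)
(* The injection of the graph is a homotopy equivalence relative to the vertices,
   so one takes for Z' the set of centers of the strips. Every boundary interval
   J of a strip has a collar {1 - |y| < gap x}, where gap x is the distance to
   the ends of J, cut off at 1/2; distinct intervals have disjoint collars, and
   every point of the strip has a neighborhood meeting at most one of them. The
   map "collapse" sends a strip minus the collars of its glued intervals to its
   vertex and stretches the collars along the edges; it is continuous on Z even
   for the weak topology of the graph. On every edge, collapsing the canonical
   map is homotopic to the identity by linear interpolation. Conversely, the
   canonical map after "collapse" is deformed to the identity of Z linearly
   inside the strips, except near the seams, where this would not be compatible
   with the gluing: there a fixed contraction of the seam to its base point is
   followed instead. Both homotopies fix the vertices, resp. the centers. *)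
From mathcomp Require Import all_boot all_order all_algebra.
From mathcomp Require Import all_classical all_reals all_analysis.
From mathcomp Require Import ring lra.
Require Import Defs.
Import Order.TTheory GRing.Theory Num.Theory.
Import numFieldNormedType.Exports.

Set Implicit Arguments.
Unset Strict Implicit.
Unset Printing Implicit Defensive.

Local Open Scope classical_set_scope.
Local Open Scope ring_scope.

(** * Continuity on subspaces and homotopies on final topologies *)

(** Near [x] the sets [D] and [D] cut by [V] have the same germs. This serves for maps defined by
    cases on the end above a point, where a single formula holds locally. *)
Lemma within_local (T U : topologicalType) (D : set T) (f : T -> U) :
  (forall x, D x -> exists V : set T, exists g : T -> U,
    [/\ open V, V x, forall y, D y -> V y -> f y = g y &
        {within D `&` V, continuous g}]) ->
  {within D, continuous f}.
Proof.
move=> loc; apply/subspace_continuousP => x Dx.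
have [V [g [oV Vx fg /subspace_continuousP cg]]] := loc x Dx.
move=> O; rewrite /= => nO; have {}nO : nbhs (g x) O by rewrite -(fg x Dx Vx).
have nV : nbhs x V by exact: open_nbhs_nbhs.
have nA : nbhs x [set y | (D `&` V) y -> O (g y)] by exact: cg.
suff : nbhs x [set y | D y -> O (f y)] by [].
by apply: filterS (filterI nA nV) => y [H Vy] Dy; rewrite fg //; exact: H.
Qed.

(** * Arithmetic of functions continuous on a subspace *)

Section WithinReal.
Variables (T : topologicalType) (R : realType) (D : set T).
Implicit Types f g : T -> R.

Lemma within_addr f g : {within D, continuous f} -> {within D, continuous g} ->
  {within D, continuous (fun x => f x + g x)}.
Proof. by move=> cf cg x; apply: cvgD; [exact: cf|exact: cg]. Qed.

Lemma within_mulr f g : {within D, continuous f} -> {within D, continuous g} ->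
  {within D, continuous (fun x => f x * g x)}.
Proof. by move=> cf cg x; apply: cvgM; [exact: cf|exact: cg]. Qed.

Lemma within_subr f g : {within D, continuous f} -> {within D, continuous g} ->
  {within D, continuous (fun x => f x - g x)}.
Proof. by move=> cf cg x; apply: cvgB; [exact: cf|exact: cg]. Qed.

Lemma within_invr f : (forall x, D x -> f x != 0) -> {within D, continuous f} ->
  {within D, continuous (fun x => (f x)^-1)}.
Proof.
move=> f0 /subspace_continuousP cf; apply/subspace_continuousP => x Dx.
by apply: cvgV; [exact: f0|exact: cf].
Qed.

Lemma within_maxr f g : {within D, continuous f} -> {within D, continuous g} ->
  {within D, continuous (fun x => Num.max (f x) (g x))}.
Proof. by move=> cf cg x; apply: continuous_max; [exact: cf|exact: cg]. Qed.

Lemma within_minr f g : {within D, continuous f} -> {within D, continuous g} ->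
  {within D, continuous (fun x => Num.min (f x) (g x))}.
Proof. by move=> cf cg x; apply: continuous_min; [exact: cf|exact: cg]. Qed.

Lemma within_cst (U : topologicalType) (u : U) : {within D, continuous (fun=> u)}.
Proof. by apply: continuous_subspaceT; exact: cst_continuous. Qed.

Lemma within_pair (U V : topologicalType) (f : T -> U) (g : T -> V) :
  {within D, continuous f} -> {within D, continuous g} ->
  {within D, continuous (fun x => (f x, g x))}.
Proof. by move=> cf cg x; apply: (cvg_pair (cf x) (cg x)). Qed.

End WithinReal.

(* The product of a final topology with a compact interval is final again: for
   a compact [C], the set of the [y] with [H (y, s)] in [U] for all [s] in [C]
   is open by the tube lemma. *)
Lemma final_homotopy_continuous (R : realType) (I : Type)
    (T : I -> topologicalType) (D : forall i, set (T i)) (Y W : topologicalType)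
    (f : forall i, T i -> Y) (H : Y * R -> W) :
  (forall U : set Y, (forall i, open (f i @^-1` U : set (subspace (D i)))) ->
    open U) ->
  (forall y, {within `[0, 1], continuous (fun s => H (y, s))}) ->
  (forall i, {within D i `*` `[0, 1], continuous (fun x => H (f i x.1, x.2))}) ->
  {within setT `*` `[0, 1], continuous H}.
Proof.
move=> final cHy cHi; apply/subspace_continuousP => -[y s0] [_ /= s0I].
move=> O; rewrite nbhsE => -[U [oU Uy] UO].
have /subspace_continuousP/(_ s0 s0I) cy := cHy y.
have nU : nbhs s0 [set s | (`[0, 1]%classic : set R) s -> U (H (y, s))].
  by apply: cy; exact: open_nbhs_nbhs.
have [e /= e0 eU] := (iffLR (nbhs_ballP _ _)) nU.
(* A compact neighborhood of [s0] in the unit interval; the radius [e / 2] keeps it inside the ball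
   of radius [e]. *)
pose C : set R := `[0, 1] `&` `[s0 - e / 2, s0 + e / 2].
have cC : compact C.
  rewrite /C setIC; apply: compact_closedI; first exact: segment_compact.
  exact: interval_closed.
pose N := [set y' | forall s, C s -> U (H (y', s))].
have oN : open N.
  apply: final => i; apply/open_subspaceP.
  (* This set is open, being an interior, and it has the same trace on [D i] as the preimage of
     [N]. *)
  exists [set x | nbhs x [set x' | D i x' -> N (f i x')]].
    rewrite openE => x /= nx; rewrite /interior.
    exact: nbhs_interior.
  apply/seteqP; split => x [nx Dx]; split => //; first exact: (nbhs_singleton nx).
  suff : \forall x' \near x, C `<=` (fun s => D i x' -> 0 <= s <= 1 -> U (H (f i x', s))).
    by apply: filterS => x' CU Dx' s Cs; apply: CU => //; case: Cs; rewrite /= in_itv.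
  have /compact_near_coveringP := cC; apply => s Cs.
  have /subspace_continuousP cx := cHi i.
  have DC : (D i `*` `[0, 1]) (x, s) by split => //; case: Cs.
  have n1 : nbhs (x, s) [set z | (D i `*` `[0, 1]) z -> U (H (f i z.1, z.2))].
    by apply: (cx _ DC); apply: open_nbhs_nbhs; split => //; exact: nx.
  have [[A B] /= [nA nB] AB] := n1.
  exists (B, A) => //= -[s' x'] [/= Bs Ax] Dx' s'I.
  by have := AB (x', s') (conj Ax Bs); apply; split => //; rewrite /= in_itv.
have Ny : N y.
  move=> s [sI]; rewrite /= in_itv /= => se; apply: eU => //.
  by rewrite /ball /= ltr_norml; lra.
exists (N, ball s0 (e / 2)).
  split; first by apply: open_nbhs_nbhs.
  by apply: nbhsx_ballx; lra.
move=> [y' s'] [/= Ny' +] [_ /= s'I]; rewrite /ball /= => s's.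
apply: UO; apply: Ny'; split => //; rewrite /= in_itv /=.
by move: s's; rewrite ltr_norml; lra.
Qed.

(** * Boundary intervals of a model strip *)

Section Gap.
Variables (R : realType) (S : set (R * R)).
Hypothesis hS : model_strip S.

(* The distance from [x] to the complement of the boundary of [S] at height
   [e], cut off at 1/2. *)
Definition gap_radii (e x : R) : set R :=
  [set r | 0 <= r <= 2^-1 /\ forall x', `|x' - x| < r -> S (x', e)].

Definition gap (e x : R) : R := sup (gap_radii e x).

Lemma has_sup_gap_radii e x : has_sup (gap_radii e x).
Proof.
split; last by exists 2^-1 => r [/andP[]].
exists 0; split; first by lra.
by move=> x'; rewrite ltNge normr_ge0.
Qed.

Lemma gap_ge0 e x : 0 <= gap e x.
Proof.
apply: ub_le_sup; first by case: (has_sup_gap_radii e x).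
by split; [lra|move=> x'; rewrite ltNge normr_ge0].
Qed.

Lemma gap_le_half e x : gap e x <= 2^-1.
Proof.
by apply: ge_sup; [case: (has_sup_gap_radii e x)|move=> r [/andP[]]].
Qed.

(** An admissible radius at [x], shortened by the distance to [x'], is admissible at [x'] by the
    triangle inequality. *)
Lemma gap_lipschitz e x x' : gap e x - `|x - x'| <= gap e x'.
Proof.
rewrite lerBlDr; apply: ge_sup; first by case: (has_sup_gap_radii e x).
move=> r [r01 rS]; rewrite -lerBlDr.
have [r0|r0] := leP (r - `|x - x'|) 0; first exact: le_trans (gap_ge0 _ _).
apply: ub_le_sup; first by case: (has_sup_gap_radii e x').
split; first by have := normr_ge0 (x - x'); lra.
move=> t tx; apply: rS.
by have := ler_distD x' t x; rewrite (distrC x'); lra.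
Qed.

Lemma gap_continuous e : continuous (gap e).
Proof.
move=> x; apply/cvgrPdist_lt => eps eps0; near=> x'.
have d : `|x - x'| < eps by near: x'; exact: cvgr_dist_lt.
have := gap_lipschitz e x x'; have := gap_lipschitz e x' x.
by rewrite (distrC x') ltr_norml; lra.
Unshelve. all: by end_near. Qed.

Lemma strip_boundary_sign p : strip_boundary S p -> p.2 = -1 \/ p.2 = 1.
Proof. by case. Qed.

(** The boundary near [(x, e)] is an open interval of the given family, which contains a ball around
    [x]. *)
Lemma gap_gt0 e x : e = -1 \/ e = 1 -> S (x, e) -> 0 < gap e x.
Proof.
move=> he Sx; have [F [_ FJ _ SF]] := strip_boundary_intervals hS.
have Bx : strip_boundary S (x, e) by split.
have := Bx; rewrite SF => -[J JF Jx].
have [I [e' [_ oI _ JE]]] := FJ _ JF.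
move: Jx; rewrite JE => -[/= Ix ee].
have [r /= r0 rI] := (iffLR (nbhs_ballP _ _)) (open_nbhs_nbhs (conj oI Ix)).
apply: (@lt_le_trans _ _ (Num.min r 2^-1)).
  by rewrite lt_min r0; lra.
apply: ub_le_sup; first by case: (has_sup_gap_radii e x).
split; first by rewrite ge_min le_min (ltW r0) lexx orbT andbT; lra.
move=> x'; rewrite lt_min => /andP[x'r _].
suff : strip_boundary S (x', e) by case.
rewrite SF; exists J => //; rewrite JE; split => //=; apply: rI.
by rewrite /ball /= distrC.
Qed.

Lemma gap_ball e x x' : `|x' - x| < gap e x -> S (x', e).
Proof.
move=> xg; have d0 : 0 < gap e x - `|x' - x| by lra.
have [r [_ rS] rg] := sup_adherent d0 (has_sup_gap_radii e x).
by apply: rS; move: rg; rewrite -/(gap e x); lra.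
Qed.

Lemma gap_segment e x x' t : `|x' - x| < gap e x -> 0 <= t <= 1 ->
  S (x + t * (x' - x), e).
Proof.
move=> xg t01; apply: (gap_ball (le_lt_trans _ xg)).
rewrite addrAC subrr add0r normrM ger0_norm; last by lra.
by have := normr_ge0 (x' - x); nra.
Qed.

(** The segment between the two points stays in the boundary, so they lie in the same connected
    component. *)
Lemma boundary_interval_near J e x x' : boundary_interval S J ->
  e = -1 \/ e = 1 -> `|x' - x| < gap e x -> J (x, e) <-> J (x', e).
Proof.
move=> [p _ JE] he xg.
pose f t : R * R := (x + t * (x' - x), e).
have cf : connected (f @` `[0, 1]).
  apply: connected_continuous_connected.
    by apply/connected_intervalP; exact: interval_is_interval.
  apply: within_pair; last exact: within_cst.
  apply: within_addr; first exact: within_cst.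
  by apply: within_mulr; [apply: continuous_subspaceT => t; exact: cvg_id|exact: within_cst].
have fB : f @` `[0, 1] `<=` strip_boundary S.
  move=> _ [t /= + <-]; rewrite in_itv /= => t01; split => //.
  exact: gap_segment.
have fx : (f @` `[0, 1]) (x, e).
  by exists 0; rewrite ?/f ?mul0r ?addr0 //= in_itv /= lexx ler01.
have fx' : (f @` `[0, 1]) (x', e).
  exists 1; rewrite /= ?in_itv /= ?lexx ?ler01 //.
  by rewrite /f mul1r addrCA subrr addr0.
have xx' := connected_component_max fx fB cf fx'.
have x'x := connected_component_max fx' fB cf fx.
by rewrite JE; split => h; apply: connected_component_trans h _.
Qed.

(** The second coordinates on [J] form a connected subset of {-1, 1}: with both values it would
    contain 0. *)
Lemma boundary_interval_snd J p p' : boundary_interval S J -> J p -> J p' ->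
  p.2 = p'.2.
Proof.
move=> JB Jp Jp'; have JS := boundary_interval_sub JB.
have cJ : connected ((fun p : R * R => p.2) @` J).
  apply: connected_continuous_connected.
    by case: JB => ? _ ->; exact: component_connected.
  by apply: continuous_subspaceT; exact: snd_continuous.
have no0 u v : J u -> J v -> u.2 = -1 -> v.2 = 1 -> False.
  move=> Ju Jv u2 v2; move/connected_intervalP : cJ => iJ.
  have [w /JS/strip_boundary_sign] : ((fun p : R * R => p.2) @` J) 0.
    by apply: (iJ (-1) 1); [exists u|exists v|lra].
  by case; lra.
by case: (strip_boundary_sign (JS _ Jp)); case: (strip_boundary_sign (JS _ Jp'));
  move=> e1 e2; rewrite ?e1 ?e2 //; exfalso; eauto.
Qed.

(** The projection of [J] to the first axis is connected, hence an interval, and the second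
    coordinate is constant on [J]. *)
Lemma boundary_interval_convex J p p' s : boundary_interval S J -> J p -> J p' ->
  0 <= s <= 1 -> J ((1 - s) * p.1 + s * p'.1, p.2).
Proof.
move=> JB Jp Jp' s01.
have cJ : connected ((fun p : R * R => p.1) @` J).
  apply: connected_continuous_connected.
    by case: JB => ? _ ->; exact: component_connected.
  by apply: continuous_subspaceT; exact: fst_continuous.
move/connected_intervalP : cJ => iJ.
have [u Ju uE] : ((fun p : R * R => p.1) @` J) ((1 - s) * p.1 + s * p'.1).
  have [pp|pp] := leP p.1 p'.1.
    by apply: (iJ p.1 p'.1); [exists p|exists p'|nra].
  by apply: (iJ p'.1 p.1); [exists p'|exists p|nra].
by rewrite -uE (boundary_interval_snd JB Jp Ju) -surjective_pairing.
Qed.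

End Gap.

(** * The identifications of a striped atlas *)

Section Ends.
Variables (R : realType) (Z : topologicalType) (q : striped_atlas R Z).
Implicit Types (a : strip_index q) (p : R * R) (u v : strip_sum (strip q)).

Definition coord u : R * R := set_val (projT2 u).

Lemma coord_strip_point a p : strip q a p -> coord (strip_point a p) = p.
Proof. by move=> /mem_set pS; rewrite /coord set_valE /= val_insubd pS. Qed.

Lemma strip_point_coord u : strip_point (projT1 u) (coord u) = u.
Proof.
case: u => a s; congr (existT _ a _); apply: val_inj; rewrite val_insubd /=.
by case: s => s /= sS; rewrite /coord set_valE /= sS.
Qed.

Lemma strip_point_val a (s : strip_space (strip q a)) :
  strip_point a (set_val s) = existT (fun a => strip_space (strip q a)) a s.
Proof. exact: (strip_point_coord (existT _ a s)). Qed.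

Lemma coord_in_strip u : strip q (projT1 u) (coord u).
Proof. by case: u => a [s sS]; rewrite /coord set_valE; exact: set_mem sS. Qed.

Lemma coord_continuous : continuous coord.
Proof.
exact: (@sigT_continuous _ (fun a => strip_space (strip q a)) _
  (fun a => set_val) (fun a => @initial_continuous _ _ _)).
Qed.

(** The quotient topology restated with the strips as subspaces of the plane, the form needed by
    [final_homotopy_continuous]. *)
Lemma glue_final (U : set Z) :
  (forall a, open ((fun p => glue q (strip_point a p)) @^-1` U :
    set (subspace (strip q a)))) -> open U.
Proof.
move=> oU; have [_ ->] := glue_quotient q; apply/sigT_openP => a.
have [V oV VE] := iffLR (open_subspaceP _ _) (oU a).
have -> : existT (fun a => strip_space (strip q a)) a @^-1` (glue q @^-1` U) =
    (set_val : strip_space (strip q a) -> R * R) @^-1` V.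
  apply/seteqP; split => s.
    move=> sU; suff : (V `&` strip q a) (set_val s) by case.
    rewrite VE; split; last exact: (coord_in_strip (existT _ a s)).
    by rewrite /= strip_point_val.
  move=> /= sV; have : (V `&` strip q a) (set_val s).
    by split => //; exact: (coord_in_strip (existT _ a s)).
  by rewrite VE => -[/= + _]; rewrite strip_point_val.
have /continuousP := @initial_continuous (strip_space (strip q a)) (R * R)%type set_val; exact.
Qed.

Lemma glue_surj w : exists u, glue q u = w.
Proof.
have [qT _] := glue_quotient q.
have : range (glue q) w by rewrite qT.
by case=> u _ <-; exists u.
Qed.

(* The two ends of the seam [b] are [(b, true)], its copy [X_b], and
   [(b, false)], its copy [Y_b]. *)
Definition seam_end : Type := (seam_index q * bool)%type.
Implicit Types c : seam_end.

Definition end_strip c := if c.2 then Xstrip q c.1 else Ystrip q c.1.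
Definition end_itv c := if c.2 then Xitv q c.1 else Yitv q c.1.
Definition end_set c := in_strip (S := strip q) (end_strip c) (end_itv c).

Lemma end_itv_boundary c : boundary_interval (strip q (end_strip c)) (end_itv c).
Proof.
by case: c => b [] /=; [exact: Xitv_boundary|exact: Yitv_boundary].
Qed.

Lemma end_itv_sub c : end_itv c `<=` strip_boundary (strip q (end_strip c)).
Proof. exact: boundary_interval_sub (end_itv_boundary c). Qed.

Lemma end_embedding c : embedding_on (end_set c) (glue q).
Proof.
by case: c => b []; [exact: glue_X_embedding|exact: glue_Y_embedding].
Qed.

Lemma glue_end c : glue q @` end_set c = seam c.1.
Proof. by case: c => b [] //; rewrite /seam (glue_XY q). Qed.

Lemma gluedP u : glued q u <-> exists c, end_set c u.
Proof.
split=> [[b _ [Xu|Yu]]|[[b []] cu]].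
- by exists (b, true).
- by exists (b, false).
- by exists b => //; left.
- by exists b => //; right.
Qed.

Lemma end_glue_inj c u v : end_set c u -> end_set c v -> glue q u = glue q v ->
  u = v.
Proof.
move=> cu cv; have [_ [g _ gK]] := end_embedding c.
by rewrite -{2}(gK _ cu) -{2}(gK _ cv) => ->.
Qed.

Lemma end_seam_uniq c c' u v : end_set c u -> end_set c' v ->
  glue q u = glue q v -> c.1 = c'.1.
Proof.
move=> cu cv uv; apply: contrapT => cc.
have := seams_disjoint cc; rewrite -!/(seam _) -!glue_end => /seteqP[/(_ (glue q u)) + _].
by apply; split; [exists u|exists v].
Qed.

(** Disjointness of the seams gives the same seam index, and [XY_disjoint] excludes opposite
    ends. *)
Lemma end_uniq c c' u : end_set c u -> end_set c' u -> c = c'.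
Proof.
move=> cu cu'; have := end_seam_uniq cu cu' erefl.
case: c cu => b t cu; case: c' cu' => b' t' cu' /= bb; subst b'; congr (_, _).
case: t cu; case: t' cu' => // h h'; exfalso.
- by have /seteqP[/(_ u) + _] := XY_disjoint q b b; apply.
- by have /seteqP[/(_ u) + _] := XY_disjoint q b b; apply.
Qed.

Lemma end_set_unglued c u v : end_set c u -> glue q u = glue q v ->
  exists2 c', end_set c' v & c'.1 = c.1.
Proof.
move=> cu uv; have [[c' cv]|nv] := pselect (exists c', end_set c' v).
  by exists c' => //; rewrite (end_seam_uniq cu cv uv).
have := seam_unglued q c.1; rewrite -/(seam _) -glue_end => /seteqP[/(_ (glue q u)) + _].
case; split; first by exists u.
by exists v => // /gluedP.
Qed.

(** The full list of identifications: a map on the strips descends to [Z] as soon as it agrees on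
    the ends of each seam. *)
Lemma glue_eq u v : glue q u = glue q v ->
  u = v \/ exists c c', [/\ end_set c u, end_set c' v & c.1 = c'.1].
Proof.
move=> uv; have [[c cu]|nu] := pselect (exists c, end_set c u).
  by have [c' cv cc] := end_set_unglued cu uv; right; exists c, c'; split.
have [[c cv]|nv] := pselect (exists c, end_set c v).
  by have [c' cu _] := end_set_unglued cv (esym uv); case: nu; exists c'.
by left; apply: (glue_inj (s := q)) uv => /gluedP.
Qed.

Lemma end_set_strip_point c p : end_itv c p -> end_set c (strip_point (end_strip c) p).
Proof.
move=> cp; split => //; rewrite -/(coord _) coord_strip_point //.
by case: (end_itv_sub cp).
Qed.

Lemma end_itv_uniq c c' p : end_strip c = end_strip c' -> end_itv c p ->
  end_itv c' p -> c = c'.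
Proof.
move=> cc cp /end_set_strip_point; rewrite -cc; apply: end_uniq.
exact: end_set_strip_point.
Qed.

End Ends.

(** * The collapse of the surface onto the graph *)

Section Collapse.
Variables (R : realType) (Z : topologicalType) (q : striped_atlas R Z).
Implicit Types (a : strip_index q) (p : R * R) (u v : strip_sum (strip q)).
Implicit Types (c : seam_end q).

(** The value at second coordinate 0 is harmless: by [height_low] the height of a point above an end
    vanishes there. *)
Definition side p : R := if 0 <= p.2 then 1 else -1.

Lemma side_sign p : side p = -1 \/ side p = 1.
Proof. by rewrite /side; case: ifP; [right|left]. Qed.

Lemma side_norm p : side p * p.2 = `|p.2|.
Proof.
rewrite /side; have [p0|p0] := leP 0 p.2; first by rewrite mul1r ger0_norm.
by rewrite mulN1r ltr0_norm.
Qed.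

Lemma side_pos p e : e = -1 \/ e = 1 -> 0 < e * p.2 -> side p = e.
Proof.
by rewrite /side => -[] -> ep; have [p0|p0] := leP 0 p.2 => //; lra.
Qed.

Lemma side_boundary a p : strip_boundary (strip q a) p -> (p.1, side p) = p.
Proof.
case: p => x y [_ /= yE]; congr (_, _); rewrite /side /=.
by case: yE => ->; have [p0|p0] := leP 0 _ => //; lra.
Qed.

(* Above or below the boundary interval of [c], according to [side p]. *)
Definition above_end a c p := end_strip c = a /\ end_itv c (p.1, side p).

Definition end_above a p : option (seam_end q) :=
  if pselect (exists c, above_end a c p) is left h then Some (projT1 (cid h))
  else None.

Lemma above_end_uniq a c c' p : above_end a c p -> above_end a c' p -> c = c'.
Proof. by move=> [ca cp] [ca' cp']; apply: end_itv_uniq cp cp'; rewrite ca. Qed.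

Variant end_above_spec a p : option (seam_end q) -> Prop :=
| EndAbove c of above_end a c p : end_above_spec a p (Some c)
| NoEndAbove of (forall c, ~ above_end a c p) : end_above_spec a p None.

Lemma end_aboveP a p : end_above_spec a p (end_above a p).
Proof.
rewrite /end_above; case: pselect => [h|h]; last first.
  by constructor => c cp; apply: h; exists c.
by constructor; case: (cid h).
Qed.

Lemma end_aboveE a c p : above_end a c p -> end_above a p = Some c.
Proof.
move=> cp; case: end_aboveP => [c' c'p|/(_ _ cp)//].
by rewrite (above_end_uniq cp c'p).
Qed.

Lemma above_end_coord c u : end_set c u -> above_end (projT1 u) c (coord u).
Proof.
move=> [uc Ju]; split => //.
by rewrite (side_boundary (a := end_strip c)) //; exact: end_itv_sub Ju.
Qed.

Definition column_gap a p := gap (strip q a) (side p) p.1.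

Lemma column_gap_gt0 a c p : above_end a c p -> 0 < column_gap a p.
Proof.
move=> [<- /end_itv_sub[cp _]].
by apply: gap_gt0 => //; [exact: stripP|exact: side_sign].
Qed.

(* 0 outside the collar [1 - |y| < gap x] of the boundary, 1 on the boundary;
   meaningless when the gap is 0, which does not happen above an end. *)
Definition height a p : R := Num.max 0 (1 - (1 - `|p.2|) / column_gap a p).

Lemma strip_norm_le1 a p : strip q a p -> `|p.2| <= 1.
Proof. by move=> /(strip_closed_sub (stripP q a)) /=; rewrite ler_norml. Qed.

Lemma interior_in_strip a p : `|p.2| < 1 -> strip q a p.
Proof.
by move=> p1; apply: (strip_open_sub (stripP q a)); move: p1; rewrite /= ltr_norml.
Qed.

Lemma height_ge0 a p : 0 <= height a p.
Proof. by rewrite le_max lexx. Qed.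

Lemma height_le1 a c p : above_end a c p -> `|p.2| <= 1 -> height a p <= 1.
Proof.
move=> cp p1; rewrite ge_max ler01 /= gerBl divr_ge0 //; first lra.
exact/ltW/(column_gap_gt0 cp).
Qed.

Lemma height_lt1 a c p : above_end a c p -> `|p.2| < 1 -> height a p < 1.
Proof.
move=> cp p1; rewrite gt_max ltr01 /= gtrBl divr_gt0 //; first lra.
exact: column_gap_gt0 cp.
Qed.

Lemma height_top a p : `|p.2| = 1 -> height a p = 1.
Proof. by move=> p1; rewrite /height p1 subrr mul0r subr0; apply/max_idPr. Qed.

Lemma height_eq0 a c p : above_end a c p -> column_gap a p <= 1 - `|p.2| ->
  height a p = 0.
Proof.
move=> cp g; apply/max_idPl; rewrite subr_le0 ler_pdivlMr ?mul1r //.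
exact: column_gap_gt0 cp.
Qed.

Lemma height_low a c p : above_end a c p -> `|p.2| <= 2^-1 -> height a p = 0.
Proof.
move=> cp p2; apply: (height_eq0 cp).
by have := gap_le_half (strip q a) (side p) p.1; rewrite -/(column_gap a p); lra.
Qed.

(** A local normal form: near [p] the points lie above one fixed end on one side, or have height 0
    whenever an end is above them. Collars thus do not accumulate, which gives the continuity of the
    collapse and of the deformation. *)
Lemma strip_local a p : strip q a p -> exists V : set (R * R), [/\ open V, V p &
  (exists c, exists2 e, e = -1 \/ e = 1 &
     forall p', V p' -> above_end a c p' /\ side p' = e) \/
  (forall p' c, V p' -> above_end a c p' -> height a p' = 0)].
Proof.
move=> Sp.
have cn : continuous (fun p : R * R => `|p.2|).
  by move=> x; apply: cvg_norm; exact: cvg_snd.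
have cs e : continuous (fun p : R * R => e * p.2).
  by move=> x; apply: cvgM; [exact: cvg_cst|exact: cvg_snd].
have cd : continuous (fun p' : R * R => `|p'.1 - p.1|).
  by move=> x; apply: cvg_norm; apply: cvgB; [exact: cvg_fst|exact: cvg_cst].
have olt (f : R * R -> R) r : continuous f -> open [set x | f x < r].
  by move=> cf; exact: (@open_comp _ _ f [set y | y < r] (fun x _ => cf x) (@open_lt _ r)).
have ogt (f : R * R -> R) r : continuous f -> open [set x | r < f x].
  by move=> cf; exact: (@open_comp _ _ f [set y | r < y] (fun x _ => cf x) (@open_gt _ r)).
have [plow|phigh] := ltP `|p.2| 2^-1.
  exists [set p' | `|p'.2| < 2^-1]; split => //; first exact: olt.
  by right => p' c /= /ltW p'2 cp; exact: height_low cp p'2.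
have pe : 0 < side p * p.2 by rewrite side_norm; lra.
pose V r := [set p' | 0 < side p * p'.2] `&` [set p' | `|p'.1 - p.1| < r].
have oV r : open (V r) by apply: openI; [exact: ogt|exact: olt].
have Vp r : 0 < r -> V r p by move=> r0; split => //=; rewrite subrr normr0.
have sV r p' : V r p' -> side p' = side p.
  by move=> [s' _]; apply: side_pos => //; exact: side_sign.
(* Above an end, a horizontal move shorter than the gap stays above the same end. *)
have [[c cp]|nc] := pselect (exists c, above_end a c p).
  exists (V (column_gap a p)); split => //.
    exact/Vp/(column_gap_gt0 cp).
  left; exists c, (side p) => [|p' Vp']; first exact: side_sign.
  have sp' := sV _ _ Vp'; split => //; case: cp Vp' => ca cp [_ /= gp'].
  split => //; rewrite sp'; apply: (iffLR (boundary_interval_near (x := p.1) _ _ _)) cp.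
  - exact: end_itv_boundary.
  - exact: side_sign.
  - by rewrite ca.
have [p1|p1] := ltP `|p.2| 1; last first.
  have {}p1 : `|p.2| = 1 by have := strip_norm_le1 Sp; lra.
  have pE : (p.1, side p) = p.
    rewrite [RHS]surjective_pairing; congr (_, _); rewrite -[p.2]mul1r.
    by move: p1; rewrite -side_norm; case: (side_sign p) => ->; lra.
  have g0 : 0 < column_gap a p.
    by apply: gap_gt0; [exact: stripP|exact: side_sign|rewrite pE].
  (* Here [p] is on an unglued boundary interval: an end above a point within the gap of [p] would
     contain [p]. *)
  exists (V (column_gap a p)); split => //; first exact: Vp.
  right => p' c Vp' cp'; exfalso; apply: nc; exists c.
  case: cp' (Vp') => ca cp' [_ /= gp']; split => //.
  apply: (iffRL (boundary_interval_near (x' := p'.1) (end_itv_boundary c) _ _)).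
  - exact: side_sign.
  - by rewrite ca.
  - by rewrite -(sV _ _ Vp').
(* These radii make the horizontal distance from [p] to [p'] less than the distance from [p'] to the
   boundary line. If [p'] were in a collar, its gap would exceed that distance and [p] would be
   above the same end. *)
exists (V ((1 - `|p.2|) / 2) `&` [set p' | `|p'.2| < (1 + `|p.2|) / 2]); split.
- by apply: openI => //; exact: olt.
- by split => /=; [apply: Vp|]; lra.
right => p' c [Vp' /= p'2] cp'; have [g|g] := leP (column_gap a p') (1 - `|p'.2|).
  exact: height_eq0 cp' g.
exfalso; apply: nc; exists c; case: (cp') (Vp') => ca cp'' [_ /= dp'].
split => //; apply: (iffLR (boundary_interval_near (x := p'.1) (end_itv_boundary c) _ _)).
- exact: side_sign.
- by rewrite distrC ca -(sV _ _ Vp') -/(column_gap a p'); lra.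
- by rewrite -(sV _ _ Vp').
Qed.

Lemma height_within a e D : e = -1 \/ e = 1 ->
  (forall p, D p -> side p = e /\ 0 < column_gap a p) ->
  {within D, continuous (height a)}.
Proof.
move=> he De.
apply: (@within_eq _ _ _
    (fun p => Num.max 0 (1 - (1 - `|p.2|) / gap (strip q a) e p.1))).
  by move=> p /De[pe _]; rewrite /height /column_gap pe.
apply: within_maxr; first exact: within_cst.
apply: within_subr; first exact: within_cst.
apply: within_mulr.
  apply: continuous_subspaceT => x; apply: cvgB; first exact: cvg_cst.
  by apply: cvg_norm; exact: cvg_snd.
apply: within_invr => [p /De[<- g]|]; first by rewrite gt_eqF.
apply: (within_comp (B := setT) (g := gap (strip q a) e)) => //.
  by apply: continuous_subspaceT; exact: fst_continuous.
by apply: continuous_subspaceT; exact: gap_continuous.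
Qed.

(* The point at height [h] of the half of the 1-cell lying in the strip of [c]. *)
Definition half_edge c (h : R) : R := (if c.2 then -1 else 1) * (1 - h).

Lemma half_edge_bound c h : 0 <= h <= 1 -> -1 <= half_edge c h <= 1.
Proof. by rewrite /half_edge; case: ifP => _; lra. Qed.

Lemma half_edge_continuous c : continuous (half_edge c).
Proof.
move=> x; apply: cvgM; first exact: cvg_cst.
by apply: cvgB; [exact: cvg_cst|exact: cvg_id].
Qed.

Lemma char_map_half_edge0 c :
  char_map (Xstrip q) (Ystrip q) c.1 (half_edge c 0) = Vertex (end_strip c).
Proof.
rewrite /half_edge /char_map /end_strip subr0 mulr1; case: insubP => [s|_].
  by case: ifP => _; rewrite ltxx ?andbF.
by case: c.2; rewrite ?lerN10 ?ler10.
Qed.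

Lemma char_map_half_edge1 c :
  char_map (Xstrip q) (Ystrip q) c.1 (half_edge c 1) =
  char_map (Xstrip q) (Ystrip q) c.1 0.
Proof. by rewrite /half_edge subrr mulr0. Qed.

Definition collapse_strip a p : atlas_graph q :=
  if end_above a p is Some c then char_map _ _ c.1 (half_edge c (height a p))
  else Vertex a.

Lemma collapse_strip0 a p : (forall c, above_end a c p -> height a p = 0) ->
  collapse_strip a p = Vertex a.
Proof.
rewrite /collapse_strip; case: end_aboveP => // c cp /(_ c cp) ->.
by rewrite char_map_half_edge0; case: cp => ->.
Qed.

Lemma char_map_continuous b :
  {within `[-1, 1], continuous (char_map (Xstrip q) (Ystrip q) b : R -> atlas_graph q)}.
Proof.
apply/continuousP => U oU.
suff oU' : graph_open U by exact: oU'.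
exact: oU.
Qed.

(** Each neighborhood given by [strip_local] is sent into a single closed cell or to a vertex, so
    the weak topology is no obstacle. *)
Lemma collapse_strip_continuous a : {within strip q a, continuous (collapse_strip a)}.
Proof.
apply: within_local => p Sp; have [V [oV Vp [[c [e he ce]]|c0]]] := strip_local Sp.
  exists V, (fun p => char_map _ _ c.1 (half_edge c (height a p))); split => //.
    by move=> p' _ /ce[cp' _]; rewrite /collapse_strip (end_aboveE cp').
  apply: (within_comp _ _ (@char_map_continuous c.1)).
    move=> p' [Sp' /ce[cp' _]]; rewrite /= in_itv /=; apply: half_edge_bound.
    by rewrite height_ge0 (height_le1 cp' (strip_norm_le1 Sp')).
  apply: (within_comp (B := setT) _ (@height_within a e _ he _)) => //.
  - move=> p' [_ /ce[cp' <-]]; split => //; exact: column_gap_gt0 cp'.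
  - apply: continuous_subspaceT; exact: half_edge_continuous.
exists V, (fun=> Vertex a); split => //; last exact: within_cst.
by move=> p' _ Vp'; apply: collapse_strip0 => c; exact: c0.
Qed.

(** Both ends of a seam go to the midpoint of its cell, so the map descends to [Z]. *)
Lemma collapse_strip_end c u : end_set c u ->
  collapse_strip (projT1 u) (coord u) = char_map _ _ c.1 0.
Proof.
move=> cu; rewrite /collapse_strip (end_aboveE (above_end_coord cu)).
rewrite height_top ?char_map_half_edge1 //.
by case: cu => _ /end_itv_sub[_ /= [] ->]; rewrite ?normrN normr1.
Qed.

Definition collapse (w : Z) : atlas_graph q :=
  let u := projT1 (cid (glue_surj q w)) in collapse_strip (projT1 u) (coord u).

Lemma collapse_glue u : collapse (glue q u) = collapse_strip (projT1 u) (coord u).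
Proof.
rewrite /collapse; case: cid => v /= vu.
case: (glue_eq vu) => [->//|[c [c' [cv c'u cc]]]].
by rewrite (collapse_strip_end cv) (collapse_strip_end c'u) cc.
Qed.

Lemma collapse_strip_point a p : strip q a p ->
  collapse (glue q (strip_point a p)) = collapse_strip a p.
Proof. by move=> Sp; rewrite collapse_glue coord_strip_point. Qed.

Lemma collapse_continuous : continuous collapse.
Proof.
apply/continuousP => U oU; apply: (glue_final (q := q)) => a.
have cr : {within strip q a, continuous (fun p => collapse (glue q (strip_point a p)))}.
  by apply: within_eq (@collapse_strip_continuous a) => p /collapse_strip_point.
by have /continuousP := cr; exact.
Qed.

End Collapse.

(** * The deformation of the surface *)

Lemma norm_convex_lt1 (R : realType) (s x y : R) : 0 <= s <= 1 -> `|x| < 1 ->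
  `|y| < 1 -> `|(1 - s) * x + s * y| < 1.
Proof.
rewrite !ltr_norml => s01 x1 y1; have [s1|s1] := ltP s 1; last first.
  have -> : s = 1 by lra.
  by rewrite subrr mul0r add0r mul1r.
have u0 : 0 <= s * (1 - y) by apply: mulr_ge0; lra.
have u1 : 0 <= s * (1 + y) by apply: mulr_ge0; lra.
have v0 : 0 < (1 - s) * (1 - x) by apply: mulr_gt0; lra.
have v1 : 0 < (1 - s) * (1 + x) by apply: mulr_gt0; lra.
lra.
Qed.

Section Contraction.
Variables (R : realType) (Z : topologicalType) (q : striped_atlas R Z).
Variable z : seam_index q -> Z.
Hypothesis zP : forall b, seam b (z b).
Implicit Types (a : strip_index q) (p : R * R) (u v : strip_sum (strip q)).
Implicit Types (c : seam_end q).

(** * Coordinates on the seams and their contraction *)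

Definition end_coord c (w : Z) : R * R := preimage_in (end_set c) (end_strip c) w.

Lemma end_coordE c u : end_set c u -> end_coord c (glue q u) = coord u.
Proof.
move=> cu; rewrite /end_coord; have [v [cv vu] ->] := @preimage_inP _ _ q (end_set c) (end_strip c)
  (glue q u) (ex_intro2 _ _ u cu erefl).
by rewrite (end_glue_inj cv cu vu).
Qed.

Lemma end_coord_glue c p : end_itv c p ->
  end_coord c (glue q (strip_point (end_strip c) p)) = p.
Proof.
move=> cp; rewrite end_coordE; last exact: end_set_strip_point.
by rewrite coord_strip_point //; case: (end_itv_sub cp).
Qed.

Lemma end_coordP c w : seam c.1 w ->
  end_itv c (end_coord c w) /\ glue q (strip_point (end_strip c) (end_coord c w)) = w.
Proof.
rewrite -glue_end => -[u cu <-]; rewrite end_coordE //.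
by case: (cu) => uc Ju; split => //; rewrite -uc strip_point_coord.
Qed.

Lemma seam_glue c p : end_itv c p -> seam c.1 (glue q (strip_point (end_strip c) p)).
Proof.
move=> cp; rewrite -glue_end; exists (strip_point (end_strip c) p) => //.
exact: end_set_strip_point.
Qed.

(** On the seam [end_coord] agrees with the continuous inverse that the embedding of the end
    provides. *)
Lemma end_coord_continuous c : {within seam c.1, continuous (end_coord c)}.
Proof.
have [_ [g cg gK]] := end_embedding c; rewrite glue_end in cg.
apply: (@within_eq _ _ _ (fun w => coord (g w))).
  move=> w; rewrite -glue_end => -[u cu <-]; rewrite gK // end_coordE //.
apply: (within_comp (B := setT) _ cg) => //.
by apply: continuous_subspaceT; exact: coord_continuous.
Qed.

Definition end_base c := end_coord c (z c.1).

Lemma end_base_itv c : end_itv c (end_base c).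
Proof. by have [] := end_coordP (zP c.1). Qed.

Lemma glue_end_base c : glue q (strip_point (end_strip c) (end_base c)) = z c.1.
Proof. by have [] := end_coordP (zP c.1). Qed.

Lemma end_itv_snd c p : end_itv c p -> p.2 = (end_base c).2.
Proof. by move=> cp; apply: boundary_interval_snd (end_itv_boundary c) cp (end_base_itv c). Qed.

(* A contraction of the seam to its base point: the two identifications of a
   seam with an interval need not be affinely related, so the linear
   contraction of the [X] end is transported to the [Y] end. *)
Definition seam_contraction (b : seam_index q) (w : Z) (s : R) : Z :=
  let x := end_base (b, true) in
  glue q (strip_point (Xstrip q b)
    ((1 - s) * x.1 + s * (end_coord (b, true) w).1, x.2)).

Lemma seam_contraction_itv b w s : seam b w -> 0 <= s <= 1 ->
  end_itv (b, true) ((1 - s) * (end_base (b, true)).1 +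
    s * (end_coord (b, true) w).1, (end_base (b, true)).2).
Proof.
move=> bw; apply: boundary_interval_convex (end_itv_boundary (b, true)) _ _.
  exact: end_base_itv.
by have [] := @end_coordP (b, true) w bw.
Qed.

Lemma seam_contraction_seam b w s : seam b w -> 0 <= s <= 1 ->
  seam b (seam_contraction b w s).
Proof.
by move=> bw s01; apply: (@seam_glue (b, true)); exact: seam_contraction_itv.
Qed.

Lemma seam_contraction0 b w : seam_contraction b w 0 = z b.
Proof.
rewrite /seam_contraction subr0 mul1r mul0r addr0 -surjective_pairing.
exact: (glue_end_base (b, true)).
Qed.

Lemma seam_contraction1 b w : seam b w -> seam_contraction b w 1 = w.
Proof.
move=> bw; have [cw {2}<-] := @end_coordP (b, true) w bw.
rewrite /seam_contraction subrr mul0r mul1r add0r -(end_itv_snd cw).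
by rewrite -surjective_pairing.
Qed.

Lemma seam_contraction_continuous b :
  {within seam b `*` `[0, 1], continuous (fun x => seam_contraction b x.1 x.2)}.
Proof.
apply: (within_comp (f := fun x : Z * R => ((1 - x.2) * (end_base (b, true)).1 +
    x.2 * (end_coord (b, true) x.1).1, (end_base (b, true)).2))
  _ _ (@strip_point_continuous _ _ q (Xstrip q b))).
  move=> [w s] [/= bw]; rewrite in_itv /= => s01.
  by have /end_itv_sub[] := seam_contraction_itv bw s01.
have cs : {within seam b `*` `[0, 1], continuous (fun x : Z * R => x.2)}.
  by apply: continuous_subspaceT => x; exact: cvg_snd.
apply: within_pair; last exact: within_cst.
apply: within_addr; apply: within_mulr => //; last 1 first.
- apply: (within_comp (B := setT) (g := fst)) => //; last first.
    by apply: continuous_subspaceT; exact: fst_continuous.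
  apply: (within_comp (f := fst) _ _ (@end_coord_continuous (b, true))); first by move=> x [].
  by apply: continuous_subspaceT => x; exact: cvg_fst.
- by apply: within_subr => //; exact: within_cst.
- exact: within_cst.
Qed.

(** The contraction of the seam read in the first coordinate of the end [c]: linear for an X end,
    transported through the gluing for a Y end. *)
Definition end_slide c (x s : R) : R :=
  (end_coord c (seam_contraction c.1
    (glue q (strip_point (end_strip c) (x, (end_base c).2))) s)).1.

Lemma glue_end_slide c p s : end_itv c p -> 0 <= s <= 1 ->
  end_itv c (end_slide c p.1 s, p.2) /\
  glue q (strip_point (end_strip c) (end_slide c p.1 s, p.2)) =
  seam_contraction c.1 (glue q (strip_point (end_strip c) p)) s.
Proof.
move=> cp s01; have bw := seam_contraction_seam (seam_glue cp) s01.
have [cw wE] := end_coordP bw.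
rewrite /end_slide -(end_itv_snd cp) -surjective_pairing.
by rewrite (end_itv_snd cp) -(end_itv_snd cw) -surjective_pairing.
Qed.

Lemma end_slide0 c x : end_slide c x 0 = (end_base c).1.
Proof. by rewrite /end_slide seam_contraction0. Qed.

Lemma end_slide1 c p : end_itv c p -> end_slide c p.1 1 = p.1.
Proof.
move=> cp; rewrite /end_slide seam_contraction1 -(end_itv_snd cp)
  -surjective_pairing ?end_coord_glue //; exact: seam_glue.
Qed.

Lemma end_slide_continuous c :
  {within [set x | end_itv c (x, (end_base c).2)] `*` `[0, 1],
    continuous (fun x => end_slide c x.1 x.2)}.
Proof.
apply: (within_comp (B := setT) (g := fst)
  (f := fun x : R * R => end_coord c (seam_contraction c.1
    (glue q (strip_point (end_strip c) (x.1, (end_base c).2))) x.2))) => //; last first.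
  by apply: continuous_subspaceT; exact: fst_continuous.
apply: (within_comp (f := fun x : R * R => seam_contraction c.1
    (glue q (strip_point (end_strip c) (x.1, (end_base c).2))) x.2) _ _ (@end_coord_continuous c)).
  move=> [x s] [/= cx]; rewrite in_itv /= => s01.
  by apply: seam_contraction_seam => //; exact: seam_glue.
apply: (within_comp (f := fun x : R * R =>
    (glue q (strip_point (end_strip c) (x.1, (end_base c).2)), x.2))
  _ _ (@seam_contraction_continuous c.1)).
  by move=> [x s] [/= cx s01]; split => //=; exact: seam_glue.
apply: within_pair; last by apply: continuous_subspaceT; exact: snd_continuous.
apply: (within_comp (f := fun x : R * R => (x.1, (end_base c).2))
  _ _ (@strip_point_continuous _ _ q (end_strip c))).
  by move=> [x s] [/= /end_itv_sub[]].
apply: within_pair; last exact: within_cst.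
by apply: continuous_subspaceT; exact: fst_continuous.
Qed.

(** The half of [edge_path] lying in the strip of [c], parametrized by height: the minimum joins the
    slanted part, up to height 1/2, to the vertical one. *)
Definition end_ray c (h : R) : R * R :=
  (Num.min 1 (2 * h) * (end_base c).1, h * (end_base c).2).

Lemma edge_path_half_edge c h : 0 <= h <= 1 ->
  edge_path z c.1 (half_edge c h) = glue q (strip_point (end_strip c) (end_ray c h)).
Proof.
move=> h01; have zE := glue_end_base.
have hE : Num.min 1 (2 * h) = if h <= 2^-1 then 2 * h else 1.
  by rewrite /Num.min; case: ifP; case: ifP => //; lra.
case: c => b [].
- rewrite /edge_path /half_edge /end_ray /= -!/(end_base (b, true)) hE.
  have -> : (-1 * (1 - h) <= - 2^-1) = (h <= 2^-1) by apply/idP/idP; lra.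
  have -> : -1 * (1 - h) <= 0 by lra.
  have -> : 1 + -1 * (1 - h) = h by ring.
  by case: ifP => // _; rewrite mul1r.
- rewrite /edge_path /half_edge /end_ray /= -!/(end_base (b, true)) -!/(end_base (b, false)) hE.
  have -> : (1 * (1 - h) <= - 2^-1) = false by apply/negbTE; rewrite -ltNge; lra.
  have -> : 1 - 1 * (1 - h) = h by ring.
  have -> : 1 + 1 * (1 - h) = 2 - h by ring.
  (* At [h = 1] the parameter of the path is 0, where [edge_path] uses the X formula; both formulas
     give the point [z b]. *)
  have [h1|h1] := leP (1 * (1 - h)) 0.
    have -> : h = 1 by lra.
    have -> : (1 <= 2^-1 :> R) = false by apply/negbTE; rewrite -ltNge; lra.
    rewrite !mul1r (_ : 2 - 1 = 1) ?mul1r -?surjective_pairing; last by ring.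
    by rewrite (zE (b, true)) (zE (b, false)).
  have [h2|h2] := leP h 2^-1.
    (* The two definitions choose different pieces only at [h = 1/2], where the pieces agree. *)
    case: ifP => // h3; have -> : h = 2^-1 by lra.
    by rewrite divff // mul1r.
  have -> : 1 * (1 - h) <= 2^-1 by lra.
  by rewrite mul1r.
Qed.

(* At time [s], the point of the strip which runs from [end_ray] at the height
   of [p] to [p]; close to the seam the first coordinate is governed by
   [end_slide], away from it by linear interpolation. *)
Definition end_contraction c (h : R) p (s : R) : R * R :=
  let w := Num.max 0 (2 * h - 1) in
  ((1 - w) * ((1 - s) * (end_ray c h).1 + s * p.1) + w * end_slide c p.1 s,
   (1 - s) * (end_ray c h).2 + s * p.2).

Definition strip_contraction a p (s : R) : R * R :=
  if end_above a p is Some c then end_contraction c (height a p) p s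
  else (s * p.1, s * p.2).

(** At height 0 the ray is at the center and the slide has weight 0, so this branch matches the
    scaling used where no end lies above. *)
Lemma end_contraction_height0 c p s : end_contraction c 0 p s = (s * p.1, s * p.2).
Proof.
rewrite /end_contraction /end_ray.
have -> : Num.max 0 (2 * 0 - 1) = 0 :> R by apply/max_idPl; lra.
have -> : Num.min 1 (2 * 0) = 0 :> R by rewrite mulr0; apply/min_idPr; lra.
by rewrite /=; congr (_, _); ring.
Qed.

Lemma strip_contraction_height0 a p s :
  (forall c, above_end a c p -> height a p = 0) ->
  strip_contraction a p s = (s * p.1, s * p.2).
Proof.
rewrite /strip_contraction; case: end_aboveP => // c cp /(_ c cp) ->.
exact: end_contraction_height0.
Qed.

(** On the boundary the height is 1, so the slide has full weight and the linear term drops out. *)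
Lemma strip_contraction_end c u s : end_set c u -> 0 <= s <= 1 ->
  strip_contraction (projT1 u) (coord u) s = (end_slide c (coord u).1 s, (coord u).2).
Proof.
move=> cu s01; rewrite /strip_contraction (end_aboveE (above_end_coord cu)).
have [_ cp] := cu; rewrite -/(coord u) in cp.
rewrite height_top /end_contraction; last first.
  by have [_ /= [] ->] := end_itv_sub cp; rewrite ?normrN normr1.
have -> : Num.max 0 (2 * 1 - 1) = 1 :> R by rewrite /Num.max; case: ifP; lra.
rewrite /end_ray subrr mul0r add0r !mul1r /= -(end_itv_snd cp).
by congr (_, _); ring.
Qed.

(** On a glued end the slide keeps the point in its interval. Elsewhere only the second coordinate
    matters, and it stays strictly between -1 and 1, except on unglued boundary points at time 1. *)
Lemma strip_contraction_in a p s : strip q a p -> 0 <= s <= 1 ->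
  strip q a (strip_contraction a p s).
Proof.
move=> Sp s01.
have [[c cu]|nu] := pselect (exists c, end_set c (strip_point a p)).
  have := strip_contraction_end cu s01; rewrite coord_strip_point //= => ->.
  have [ac] := cu; rewrite -/(coord (strip_point a p)) coord_strip_point // => cp.
  by have [/end_itv_sub[+ _] _] := glue_end_slide cp s01; rewrite -ac.
have p1 := strip_norm_le1 Sp.
rewrite /strip_contraction; case: end_aboveP => [c cp|_].
  have {}p1 : `|p.2| < 1.
    (* A point above an end with second coordinate of modulus 1 lies on that end, a case already
       treated. *)
    rewrite lt_neqAle p1 andbT; apply/eqP => p2; apply: nu; exists c.
    case: cp => ac cp; split => //; rewrite -/(coord (strip_point a p)) coord_strip_point //.
    rewrite -(side_boundary (a := a) (p := p)) //; split => //=; move: p2.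
    have [p0|p0] := leP 0 p.2; first by rewrite ger0_norm //; right.
    by rewrite ltr0_norm // => p2; left; lra.
  apply: interior_in_strip => /=.
  have h1 := height_lt1 cp p1; have h0 := height_ge0 a p.
  have := end_itv_sub (end_base_itv c) => -[_ /=].
  move=> xc; apply: norm_convex_lt1 => //.
  by case: xc => ->; rewrite ?mulrN ?normrN mulr1 ger0_norm.
have [s1|s1] := ltP s 1; last first.
  have -> : s = 1 by lra.
  by rewrite !mul1r -surjective_pairing.
apply: interior_in_strip => /=; rewrite normrM ger0_norm; last lra.
by have := normr_ge0 p.2; nra.
Qed.

Lemma strip_contraction_continuous a :
  {within strip q a `*` `[0, 1], continuous (fun x => strip_contraction a x.1 x.2)}.
Proof.
have c2 D : {within D, continuous (fun x : R * R * R => x.2)}.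
  by apply: continuous_subspaceT => x; exact: cvg_snd.
have c1 D : {within D, continuous (fun x : R * R * R => x.1)}.
  by apply: continuous_subspaceT => x; exact: cvg_fst.
have c11 D : {within D, continuous (fun x : R * R * R => x.1.1)}.
  apply: (within_comp (B := setT) (g := fst) _ (c1 D)) => //.
  by apply: continuous_subspaceT; exact: fst_continuous.
have c12 D : {within D, continuous (fun x : R * R * R => x.1.2)}.
  apply: (within_comp (B := setT) (g := snd) _ (c1 D)) => //.
  by apply: continuous_subspaceT; exact: snd_continuous.
apply: within_local => -[p s] [/= Sp s01].
have [V [oV Vp H]] := strip_local Sp.
have oV' : open [set x : R * R * R | V x.1].
  by apply: (@open_comp _ _ (fun x : R * R * R => x.1) V _ oV) => x _; exact: cvg_fst.
case: H => [[c [e he ce]]|c0]; last first.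
  exists [set x | V x.1], (fun x => (x.2 * x.1.1, x.2 * x.1.2)); split => //.
    by move=> [p' s'] _ /= Vp'; apply: strip_contraction_height0 => c; exact: c0.
  by apply: within_pair; apply: within_mulr.
exists [set x | V x.1], (fun x => end_contraction c (height a x.1) x.1 x.2); split => //.
  by move=> [p' s'] _ /= /ce[cp' _]; rewrite /strip_contraction (end_aboveE cp').
set D := _ `&` _.
have ch : {within D, continuous (fun x : R * R * R => height a x.1)}.
  apply: (within_comp (f := fst) (B := V) _ (c1 D)) => [x []//|].
  by apply: (height_within he) => p' /ce[cp' <-]; split => //; exact: column_gap_gt0 cp'.
have cw : {within D, continuous (fun x : R * R * R => Num.max 0 (2 * height a x.1 - 1))}.
  apply: within_maxr; first exact: within_cst.
  apply: within_subr; last exact: within_cst.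
  by apply: within_mulr => //; exact: within_cst.
have c1s : {within D, continuous (fun x : R * R * R => 1 - x.2)}.
  by apply: within_subr => //; exact: within_cst.
have cslide : {within D, continuous (fun x : R * R * R => end_slide c x.1.1 x.2)}.
  apply: (within_comp (f := fun x : R * R * R => (x.1.1, x.2)) _ _ (@end_slide_continuous c)).
    move=> [p' s'] [/= [_ s'01] /ce[[_ cp'] _]]; split => //=.
    by rewrite -(end_itv_snd cp').
  exact: within_pair.
rewrite /end_contraction /end_ray.
apply: within_pair; apply: within_addr; apply: within_mulr => //.
- by apply: within_subr => //; exact: within_cst.
- apply: within_addr; apply: within_mulr => //; apply: within_mulr.
    apply: within_minr; first exact: within_cst.
    by apply: within_mulr => //; exact: within_cst.
  exact: within_cst.
- by apply: within_mulr => //; exact: within_cst.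
Qed.

Lemma canonical_map_collapse_strip a p : strip q a p ->
  canonical_map z (collapse_strip a p) = glue q (strip_point a (strip_contraction a p 0)).
Proof.
move=> Sp; rewrite /collapse_strip /strip_contraction.
case: end_aboveP => [c cp|_]; last by rewrite !mul0r strip_point_center.
have h01 : 0 <= height a p <= 1.
  by rewrite height_ge0 (height_le1 cp (strip_norm_le1 Sp)).
rewrite canonical_map_edge ?edge_path_half_edge ?half_edge_bound //.
case: (cp) => -> _; congr (glue q (strip_point a _)).
rewrite /end_contraction /end_ray end_slide0 /= subr0 !mul1r !mul0r !addr0.
(* With [w] the maximum and [m] the minimum, [(1 - w) * m + w = m]: up to height 1/2 the weight [w]
   is 0, and beyond it [m] is 1. *)
congr (_, _); rewrite /Num.max /Num.min; do 2 case: ifP; move=> h1 h2; try ring; lra.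
Qed.

Lemma strip_contraction1 a p : strip q a p -> strip_contraction a p 1 = p.
Proof.
move=> Sp; rewrite /strip_contraction; case: end_aboveP => [c [_ cp]|_].
  rewrite /end_contraction (@end_slide1 c (p.1, side p)) //= subrr !mul0r !add0r.
  by rewrite !mul1r -mulrDl subrK mul1r -surjective_pairing.
by rewrite !mul1r -surjective_pairing.
Qed.

(** * The deformation descended to the surface *)

Definition contraction (x : Z * R) : Z :=
  let u := projT1 (cid (glue_surj q x.1)) in
  glue q (strip_point (projT1 u) (strip_contraction (projT1 u) (coord u) x.2)).

(** The right-hand side depends only on the point of the seam and not on the end chosen over it, so
    the deformation is well defined on [Z]. *)
Lemma contraction_end c u s : end_set c u -> 0 <= s <= 1 ->
  glue q (strip_point (projT1 u) (strip_contraction (projT1 u) (coord u) s)) =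
  seam_contraction c.1 (glue q u) s.
Proof.
move=> cu s01; rewrite (strip_contraction_end cu s01); have [uc cp] := cu.
have [_] := glue_end_slide cp s01.
by rewrite -uc -/(coord u) strip_point_coord.
Qed.

Lemma contraction_glue u s : 0 <= s <= 1 -> contraction (glue q u, s) =
  glue q (strip_point (projT1 u) (strip_contraction (projT1 u) (coord u) s)).
Proof.
move=> s01; rewrite /contraction; case: cid => v /= vu.
case: (glue_eq vu) => [->//|[c [c' [cv c'u cc]]]].
by rewrite (contraction_end cv) // (contraction_end c'u) // cc vu.
Qed.

Lemma contraction_strip_point a p s : strip q a p -> 0 <= s <= 1 ->
  contraction (glue q (strip_point a p), s) =
  glue q (strip_point a (strip_contraction a p s)).
Proof. by move=> Sp s01; rewrite contraction_glue // coord_strip_point. Qed.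

Lemma contraction_continuous : {within setT `*` `[0, 1], continuous contraction}.
Proof.
have cK a : {within strip q a `*` `[0, 1],
    continuous (fun x => contraction (glue q (strip_point a x.1), x.2))}.
  apply: (@within_eq _ _ _
    (fun x => glue q (strip_point a (strip_contraction a x.1 x.2)))).
    move=> [p s] [/= Sp]; rewrite in_itv /= => s01.
    by rewrite contraction_strip_point.
  apply: (within_comp (f := fun x => strip_contraction a x.1 x.2) _
    (@strip_contraction_continuous a) (@strip_point_continuous _ _ q a)).
  by move=> [p s] [/= Sp]; rewrite in_itv /=; exact: strip_contraction_in.
(* What remains is continuity in time at a fixed point, read in a strip that contains a preimage. *)
apply: (final_homotopy_continuous (@glue_final _ _ q) _ cK) => y.
have [u <-] := glue_surj q y.
apply: (@within_eq _ _ _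
    (fun s => contraction (glue q (strip_point (projT1 u) (coord u)), s))).
  by move=> s _; rewrite strip_point_coord.
apply: (within_comp (f := fun s : R => (coord u, s)) _ _ (cK (projT1 u))).
  by move=> s s01; split => //; exact: coord_in_strip.
apply: within_pair; first exact: within_cst.
by apply: continuous_subspaceT => s; exact: cvg_id.
Qed.

Lemma contraction0 w : contraction (w, 0) = canonical_map z (collapse q w).
Proof.
have [u <-] := glue_surj q w; have Su := coord_in_strip u.
rewrite contraction_glue ?collapse_glue ?canonical_map_collapse_strip //.
by rewrite lexx ler01.
Qed.

Lemma contraction1 w : contraction (w, 1) = w.
Proof.
have [u <-] := glue_surj q w; have Su := coord_in_strip u.
rewrite contraction_glue ?strip_contraction1 ?strip_point_coord //.
by rewrite lexx ler01.
Qed.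

Lemma contraction_center a s : 0 <= s <= 1 ->
  contraction (glue q (strip_center a), s) = glue q (strip_center a).
Proof.
move=> s01; have S0 : strip q a (0, 0) by apply: interior_in_strip; rewrite normr0.
rewrite -strip_point_center contraction_strip_point //.
rewrite strip_contraction_height0 /= ?mulr0 // => c cp.
by apply: (height_low cp); rewrite normr0; lra.
Qed.

End Contraction.

(** * The deformation of the graph *)

Section GraphHomotopy.
Variables (R : realType) (Z : topologicalType) (q : striped_atlas R Z).
Variable z : seam_index q -> Z.
Hypothesis zP : forall b, seam b (z b).
Implicit Types (a : strip_index q) (b : seam_index q) (c : seam_end q).
Local Notation chi := (char_map (Xstrip q) (Ystrip q)).

Definition end_gap c : R :=
  gap (strip q (end_strip c)) (end_base z c).2 (end_base z c).1.

Lemma end_base_sign c : (end_base z c).2 = -1 \/ (end_base z c).2 = 1.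
Proof. by have [] := end_itv_sub (end_base_itv zP c). Qed.

Lemma end_gap_gt0 c : 0 < end_gap c.
Proof.
apply: gap_gt0; [exact: stripP|exact: end_base_sign|rewrite -surjective_pairing].
by have [] := end_itv_sub (end_base_itv zP c).
Qed.

Lemma end_gap_le c : end_gap c <= 2^-1.
Proof. exact: gap_le_half. Qed.

(** The function [height] along the vertical part of [end_ray], whose column gap is constantly
    [end_gap c]. *)
Definition end_height c (h : R) : R := Num.max 0 (1 - (1 - h) / end_gap c).

Lemma end_height_bound c h : h <= 1 -> 0 <= end_height c h <= 1.
Proof.
move=> h1; rewrite le_max lexx ge_max ler01 /= gerBl divr_ge0 //; first lra.
exact/ltW/end_gap_gt0.
Qed.

Lemma end_height_low c h : h <= 2^-1 -> end_height c h = 0.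
Proof.
move=> h2; apply/max_idPl; rewrite subr_le0 ler_pdivlMr ?end_gap_gt0 // mul1r.
by have := end_gap_le c; lra.
Qed.

Lemma end_height1 c : end_height c 1 = 1.
Proof. by rewrite /end_height subrr mul0r subr0; apply/max_idPr. Qed.

Lemma end_height_continuous c : continuous (end_height c).
Proof.
apply: max_continuous; first exact: cst_continuous.
by apply: (@affine_continuous _ _ (1 - (end_gap c)^-1) (end_gap c)^-1) => t; ring.
Qed.

Lemma end_ray_norm c h : 0 <= h -> `|(end_ray z c h).2| = h.
Proof.
move=> h0; rewrite normrM ger0_norm //.
by case: (end_base_sign c) => ->; rewrite ?normrN normr1 mulr1.
Qed.

Lemma end_ray_in_strip c h : 0 <= h <= 1 -> strip q (end_strip c) (end_ray z c h).
Proof.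
move=> /andP[h0 h1]; have [h2|h2] := ltP h 1.
  by apply: interior_in_strip; rewrite end_ray_norm.
have -> : h = 1 by lra.
rewrite /end_ray mulr1 (_ : Num.min 1 2 = 1) ?mul1r -?surjective_pairing; last first.
  by rewrite /Num.min; case: ifP; lra.
by have [] := end_itv_sub (end_base_itv zP c).
Qed.

(** Up to height 1/2 both sides are the vertex. Beyond it the ray is vertical and stays above [c],
    so only the height is reparametrized. *)
Lemma collapse_half_edge c h : 0 <= h <= 1 ->
  collapse q (canonical_map z (chi c.1 (half_edge c h))) =
  chi c.1 (half_edge c (end_height c h)).
Proof.
move=> h01; rewrite canonical_map_edge ?half_edge_bound // edge_path_half_edge //.
have Sr := end_ray_in_strip c h01; rewrite collapse_strip_point //.
have hn : `|(end_ray z c h).2| = h by apply: end_ray_norm; lra.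
have [h2|h2] := leP h 2^-1.
  rewrite end_height_low // char_map_half_edge0 collapse_strip0 // => c' c'r.
  by apply: (height_low c'r); rewrite hn.
have rE : end_ray z c h = ((end_base z c).1, h * (end_base z c).2).
  rewrite /end_ray (_ : Num.min 1 (2 * h) = 1) ?mul1r //.
  by rewrite /Num.min; case: ifP; lra.
have sE : side (end_ray z c h) = (end_base z c).2.
  apply: side_pos; first exact: end_base_sign.
  by rewrite rE /=; case: (end_base_sign c) => ->; lra.
have cr : above_end (end_strip c) c (end_ray z c h).
  split => //; rewrite sE rE /= -surjective_pairing; exact: end_base_itv.
rewrite /collapse_strip (end_aboveE cr); congr (chi _ (half_edge c _)).
by rewrite /height /column_gap hn sE rE.
Qed.

(** For each [t] at least one summand is taken at height 1, where [half_edge] vanishes. The sum thus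
    joins the two halves without pasting. *)
Definition edge_stretch b (t : R) : R :=
  half_edge (b, true) (end_height (b, true) (1 + Num.min t 0)) +
  half_edge (b, false) (end_height (b, false) (1 - Num.max t 0)).

Lemma edge_stretch_left b t : t <= 0 ->
  edge_stretch b t = half_edge (b, true) (end_height (b, true) (1 + t)).
Proof.
move=> t0; rewrite /edge_stretch (min_idPl t0) (max_idPr t0) subr0 end_height1.
by rewrite {2}/half_edge subrr mulr0 addr0.
Qed.

Lemma edge_stretch_right b t : 0 <= t ->
  edge_stretch b t = half_edge (b, false) (end_height (b, false) (1 - t)).
Proof.
move=> t0; rewrite /edge_stretch (min_idPr t0) (max_idPl t0) addr0 end_height1.
by rewrite {1}/half_edge subrr mulr0 add0r.
Qed.

Lemma edge_stretch_bound b t : -1 <= edge_stretch b t <= 1.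
Proof.
have [t0|/ltW t0] := leP t 0.
  by rewrite edge_stretch_left // half_edge_bound // end_height_bound; lra.
by rewrite edge_stretch_right // half_edge_bound // end_height_bound; lra.
Qed.

Lemma edge_stretchN1 b : edge_stretch b (-1) = -1.
Proof.
rewrite edge_stretch_left; last by lra.
by rewrite subrr end_height_low ?/half_edge /=; lra.
Qed.

Lemma edge_stretch1 b : edge_stretch b 1 = 1.
Proof.
rewrite edge_stretch_right; last by lra.
by rewrite subrr end_height_low ?/half_edge /=; lra.
Qed.

Lemma edge_stretch_continuous b : continuous (edge_stretch b).
Proof.
have cmp (f g : R -> R) : continuous f -> continuous g -> continuous (fun t => g (f t)).
  by move=> cf cg t; apply: (cvg_comp _ _ (cf t)); exact: cg.
have cid : continuous (fun t : R => t) by move=> t; exact: cvg_id.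
move=> t; apply: cvgD; move: t; apply: (cmp _ _); try exact: half_edge_continuous;
  apply: (cmp _ _); try exact: end_height_continuous; move=> t.
- by apply: cvgD; [exact: cvg_cst|apply: min_continuous => //; exact: cst_continuous].
- by apply: cvgB; [exact: cvg_cst|apply: max_continuous => //; exact: cst_continuous].
Qed.

Lemma collapse_edge b t : -1 <= t <= 1 ->
  collapse q (canonical_map z (chi b t)) = chi b (edge_stretch b t).
Proof.
move=> t1; have [t0|/ltW t0] := leP t 0.
  rewrite edge_stretch_left // -(@collapse_half_edge (b, true)); last by lra.
  by congr (collapse q (canonical_map z (chi b _))); rewrite /half_edge /=; ring.
rewrite edge_stretch_right // -(@collapse_half_edge (b, false)); last by lra.
by congr (collapse q (canonical_map z (chi b _))); rewrite /half_edge /=; ring.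
Qed.

Lemma char_mapN1 b : chi b (-1 : R) = Vertex (Xstrip q b).
Proof.
have := char_map_half_edge0 (b, true).
by rewrite /half_edge subr0 mulr1.
Qed.

Lemma char_map1 b : chi b (1 : R) = Vertex (Ystrip q b).
Proof.
have := char_map_half_edge0 (b, false).
by rewrite /half_edge subr0 mulr1.
Qed.

Lemma cell_bound (t : {t : R | -1 < t < 1}) : -1 < val t < 1.
Proof. exact: (valP t). Qed.

Lemma char_map_val b (t : {t : R | -1 < t < 1}) : chi b (val t) = EdgePoint b t.
Proof. by rewrite /char_map valK. Qed.

Lemma char_map_cases (t : R) : -1 <= t <= 1 ->
  [\/ t = -1, t = 1 | exists s : {t : R | -1 < t < 1}, val s = t].
Proof.
move=> t1; have [t2|t2] := boolP (-1 < t < 1).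
  by constructor 3; exists (exist _ t t2).
by move: t2; rewrite negb_and -!leNgt => /orP[] ?; [constructor 1|constructor 2]; lra.
Qed.

Definition graph_homotopy (x : atlas_graph q * R) : atlas_graph q :=
  match x.1 with
  | Vertex a => Vertex a
  | EdgePoint b t => chi b ((1 - x.2) * edge_stretch b (val t) + x.2 * val t)
  end.

(** The stretch fixes -1 and 1, so the interpolation is constant there and agrees with the vertex
    branch. *)
Lemma graph_homotopy_edge b t s : -1 <= t <= 1 ->
  graph_homotopy (chi b t, s) = chi b ((1 - s) * edge_stretch b t + s * t).
Proof.
case/char_map_cases => [->|->|[u <-]].
- by rewrite edge_stretchN1 -mulrDl subrK mul1r char_mapN1.
- by rewrite edge_stretch1 -mulrDl subrK mul1r char_map1.
- by rewrite char_map_val.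
Qed.

Lemma graph_homotopy_continuous :
  {within setT `*` `[0, 1], continuous graph_homotopy}.
Proof.
have cH b : {within `[-1, 1] `*` `[0, 1],
    continuous (fun x : R * R => graph_homotopy (chi b x.1, x.2))}.
  apply: (@within_eq _ _ _
    (fun x : R * R => chi b ((1 - x.2) * edge_stretch b x.1 + x.2 * x.1))).
    by move=> [t s] [/= + _]; rewrite in_itv /= => /graph_homotopy_edge ->.
  apply: (within_comp (f := fun x : R * R => (1 - x.2) * edge_stretch b x.1 + x.2 * x.1)
    _ _ (@char_map_continuous _ _ q b)).
    move=> [t s] [/=]; rewrite !in_itv /= => t1 s01.
    by have := edge_stretch_bound b t; nra.
  apply: continuous_subspaceT => x; apply: cvgD; apply: cvgM.
  - by apply: cvgB; [exact: cvg_cst|exact: cvg_snd].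
  - exact: (@continuous_comp _ _ _ (fun x : R * R => x.1) (edge_stretch b) x
      (@fst_continuous _ x) (@edge_stretch_continuous b x.1)).
  - exact: cvg_snd.
  - exact: cvg_fst.
apply: (final_homotopy_continuous (f := chi) _ _ cH) => [U oU|g].
  suff oU' : graph_open U by exact: oU'.
  exact: oU.
(* A vertex may lie on no cell; the homotopy is constant there. *)
case: g => [a|b t]; first exact: within_cst.
rewrite -char_map_val.
apply: (within_comp (f := fun s : R => (val t, s)) _ _ (cH b)).
  by move=> s s01; split => //; rewrite /= in_itv /=; case/andP: (cell_bound t) => t1 t2; rewrite !ltW.
apply: within_pair; first exact: within_cst.
by apply: continuous_subspaceT => s; exact: cvg_id.
Qed.

Lemma coord_center a : coord (strip_center a) = (0, 0).
Proof.
by rewrite -strip_point_center coord_strip_point //; apply: interior_in_strip; rewrite normr0.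
Qed.

Lemma collapse_center a : collapse q (glue q (strip_center a)) = Vertex a.
Proof.
rewrite -strip_point_center collapse_strip_point.
  by apply: collapse_strip0 => c cp; apply: (height_low cp); rewrite normr0; lra.
by apply: interior_in_strip; rewrite normr0.
Qed.

Lemma graph_homotopy0 g : graph_homotopy (g, 0) = collapse q (canonical_map z g).
Proof.
case: g => [a|b t]; first by rewrite /= collapse_center.
rewrite -char_map_val collapse_edge; last by have := cell_bound t; lra.
by rewrite graph_homotopy_edge ?subr0 ?mul1r ?mul0r ?addr0 //; have := cell_bound t; lra.
Qed.

Lemma graph_homotopy1 g : graph_homotopy (g, 1) = g.
Proof.
case: g => [//|b t]; rewrite -char_map_val graph_homotopy_edge.
  by rewrite subrr mul0r add0r mul1r.
by have := cell_bound t; lra.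
Qed.

(** An interior point of a cell is sent to a point of a ray at positive height, while a center has
    height 0 and lies on no end. Hence only vertices map to centers. *)
Lemma canonical_map_center (g : atlas_graph q) a :
  canonical_map z g = glue q (strip_center a) -> g = Vertex a.
Proof.
case: g => [a'|b t] /= => [gE|].
  by have := congr1 (collapse q) gE; rewrite !collapse_center => -[->].
have [c [h h01 [cb ch]]] : exists c, exists2 h, 0 < h <= 1 &
    c.1 = b /\ half_edge c h = val t.
  have t1 := cell_bound t; have [t0|t0] := leP (val t) 0.
    by exists (b, true), (1 + val t); [lra|split => //; rewrite /half_edge /=; ring].
  by exists (b, false), (1 - val t); [lra|split => //; rewrite /half_edge /=; ring].
have h01' : 0 <= h <= 1 by lra.
have Sr := end_ray_in_strip c h01'.
rewrite -cb -ch edge_path_half_edge // => /glue_eq[/(congr1 (@coord _ _ q))|].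
  rewrite coord_strip_point // coord_center => rE.
  have h0 : 0 <= h by lra.
  by exfalso; have := end_ray_norm c h0; rewrite rE normr0; lra.
move=> [_ [c' [_ [_ /end_itv_sub[_ s1]] _]]]; exfalso.
by move: s1; rewrite -/(coord (strip_center a)) coord_center /=; case; lra.
Qed.

End GraphHomotopy.

(** * The isomorphism of groupoids *)

(** Following [p] through a deformation that is stationary at both endpoints is a homotopy relative
    to them. *)
Lemma deformation_path_homotopic (R : realType) (W : topologicalType)
    (H : W * R -> W) (p : R -> W) :
  {within setT `*` `[0, 1], continuous H} -> continuous_path p ->
  (forall w, H (w, 1) = w) ->
  (forall s, 0 <= s <= 1 -> H (p 0, s) = p 0) ->
  (forall s, 0 <= s <= 1 -> H (p 1, s) = p 1) ->
  path_homotopic (fun t => H (p t, 0)) p.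
Proof.
move=> cH cp H1 Hp0 Hp1; exists (fun x => H (p x.1, x.2)); split.
- apply: (within_comp (f := fun x : R * R => (p x.1, x.2)) _ _ cH).
    by move=> x [].
  apply: within_pair; last by apply: continuous_subspaceT; exact: snd_continuous.
  apply: (within_comp (f := fst) _ _ cp); first by move=> x [].
  by apply: continuous_subspaceT; exact: fst_continuous.
- by [].
- by move=> t _; rewrite H1.
- by move=> s s01; rewrite !Hp0 // lexx ler01.
- by move=> s s01; rewrite !Hp1 // lexx ler01.
Qed.

Lemma path_connected_to_refl (R : realType) (W : topologicalType) (w : W) :
  path_connected_to R w w.
Proof.
by exists (cst w); split => //; apply: continuous_subspaceT; exact: cst_continuous.
Qed.

Lemma map_class_cancel (R : realType) (W V : topologicalType) (f : W -> V)
    (g : V -> W) (cf : continuous f) (cg : continuous g) (W' : set W) (V' : set V)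
    (fW : W' `<=` f @^-1` V') (gV : V' `<=` g @^-1` W') :
  (forall p : based_path R W', path_homotopic (fun t => g (f (p t))) p) ->
  cancel (map_class (R := R) cf fW) (map_class cg gV).
Proof.
move=> gfp c; rewrite -[RHS]reprK; apply/path_class_eqP.
apply: (path_homotopic_trans _ (gfp (repr c))).
exact: map_homotopic cg (repr_homotopic (map_path cf fW (repr c))).
Qed.

(** * Centers and vertices as base points *)

Section BasePoints.
Variables (R : realType) (Z : topologicalType) (q : striped_atlas R Z).
Variable z : seam_index q -> Z.
Hypothesis zP : forall b, seam b (z b).

Definition centers : set Z := range (fun a => glue q (strip_center a)).

Lemma meets_all_path_components_centers : meets_all_path_components R centers.
Proof.
move=> w; have [u <-] := glue_surj q w.
have p1 := strip_norm_le1 (coord_in_strip u).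
exists (glue q (strip_center (projT1 u))); first by exists (projT1 u).
exists (fun t => glue q (strip_point (projT1 u)
  ((1 - t) * (coord u).1, (1 - t) * (coord u).2))); split.
- apply: (within_comp (f := fun t : R => ((1 - t) * (coord u).1, (1 - t) * (coord u).2))
    _ _ (@strip_point_continuous _ _ q (projT1 u))).
    (* The segment to the center can touch the boundary only at time 0; afterwards it is in the open
       strip. *)
    move=> t; rewrite /= in_itv /= => t01; have [t0|t0] := leP t 0.
      have -> : t = 0 by lra.
      by rewrite subr0 !mul1r -surjective_pairing; exact: coord_in_strip.
    apply: interior_in_strip => /=; rewrite normrM ger0_norm; last by lra.
    by have := normr_ge0 (coord u).2; nra.
  have c1 : {within `[0, 1], continuous (fun t : R => 1 - t)}.
    by apply: continuous_subspaceT; apply: (@affine_continuous _ _ 1 (-1)) => t; ring.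
  by apply: within_pair; apply: within_mulr => //; exact: within_cst.
- by rewrite subr0 !mul1r -surjective_pairing strip_point_coord.
- by rewrite subrr !mul0r strip_point_center.
Qed.

Lemma meets_all_path_components_vertices :
  meets_all_path_components R (canonical_map z @^-1` centers).
Proof.
case=> [a|b t]; first by exists (Vertex a); [exists a|exact: path_connected_to_refl].
exists (Vertex (Xstrip q b)); first by exists (Xstrip q b).
(* The point of the cell slides to its initial vertex, at parameter -1. *)
have [r r1 rt] : exists2 r : R, -1 < r < 1 & val t = r.
  by exists (val t) => //; exact: cell_bound.
exists (fun s => char_map (Xstrip q) (Ystrip q) b ((1 - s) * r + s * -1)); split.
- apply: (within_comp (f := fun s : R => (1 - s) * r + s * -1) _ _
    (@char_map_continuous _ _ q b)).
    move=> s; rewrite /= !in_itv /= => s01.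
    have u0 : 0 <= (1 - s) * (1 - r) by apply: mulr_ge0; lra.
    have u1 : 0 <= (1 - s) * (r + 1) by apply: mulr_ge0; lra.
    by lra.
  apply: continuous_subspaceT.
  by apply: (@affine_continuous _ _ r (- 1 - r)) => s; ring.
- by rewrite subr0 mul1r mul0r addr0 -rt char_map_val.
- by rewrite subrr mul0r mul1r add0r char_mapN1.
Qed.

End BasePoints.

Theorem theorem2p9 (R : realType) (Z : topologicalType) (surfZ : surface R Z)
    (q : striped_atlas R Z) (z : seam_index q -> Z)
    (zP : forall b, seam b (z b)) :
  exists Z' : set Z,
    [/\ meets_all_path_components R Z',
        meets_all_path_components R (canonical_map z @^-1` Z') &
        groupoid_isomorphism
          (Pi1_map R (canonical_map_continuous zP)
             (@subset_refl _ (canonical_map z @^-1` Z')))].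
Proof.
exists (centers q); split.
- exact: meets_all_path_components_centers.
- exact: meets_all_path_components_vertices.
have vertexP (g : atlas_graph q) : (canonical_map z @^-1` centers q) g ->
    exists a, g = Vertex a.
  by move=> [a _ /esym/(canonical_map_center zP) ->]; exists a.
have colW : centers q `<=` collapse q @^-1` (canonical_map z @^-1` centers q).
  by move=> _ [a _ <-] /=; rewrite collapse_center; exists a.
(* The inverse functor is induced by [collapse], which sends each center back to its vertex. *)
exists (Pi1_map R (@collapse_continuous _ _ q) colW); split.
- move=> [g gW]; apply: val_inj => /=.
  by have [a ->] := vertexP g (set_mem gW); rewrite /= collapse_center.
- move=> [w wW]; apply: val_inj => /=.
  by have [a _ <-] := set_mem wW; rewrite collapse_center.
- apply: map_class_cancel => p.
  (* Both endpoints are vertices, which [graph_homotopy] fixes at all times. *)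
  have [a pa] := vertexP _ (set_mem (path_fun_source p)).
  have [b pb] := vertexP _ (set_mem (path_fun_target p)).
  apply: (path_homotopic_eq (p := fun t => graph_homotopy z (path_fun p t, 0))).
    by move=> t _; rewrite graph_homotopy0.
  apply: deformation_path_homotopic.
  + exact: graph_homotopy_continuous.
  + exact: path_fun_continuous.
  + exact: graph_homotopy1.
  + by move=> s _; rewrite pa.
  + by move=> s _; rewrite pb.
- apply: map_class_cancel => p.
  have [a _ pa] := set_mem (path_fun_source p).
  have [b _ pb] := set_mem (path_fun_target p).
  apply: (path_homotopic_eq (p := fun t => contraction z (path_fun p t, 0))).
    by move=> t _; rewrite contraction0.
  apply: deformation_path_homotopic.
  + exact: contraction_continuous.
  + exact: path_fun_continuous.
  + exact: contraction1.
  + by move=> s s01; rewrite -pa contraction_center.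
  + by move=> s s01; rewrite -pb contraction_center.
Qed.
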